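(* Let the ground field be $\mathbb{C}$ and let $\delta\in\mathbb{C}$. The $2$-tonal partition algebras $P^2_n(\delta)$ are semisimple for all $n\in\mathbb{N}$ if and only if $\delta\notin\mathbb{N}_0$. (If $\delta=0$ then, for $n>0$, $P^2_n(\delta)$ is semisimple if and only if $n$ is odd.)
   Context: $\mathbb{N}=\{1,2,3,\dots\}$ and $\mathbb{N}_0=\mathbb{N}\cup\{0\}$. Partition algebra: for $n\in\mathbb{N}$ let $\mathtt{P}_n$ be the set of all set partitions of $\{1,\dots,n\}\cup\{1',\dots,n'\}$ (upper nodes $1,\dots,n$; lower nodes $1',\dots,n'$). For $\delta\in\mathbb{C}$ the partition algebra $P_n(\delta)$ is the $\mathbb{C}$-algebra with basis $\mathtt{P}_n$ and the following multiplication: for $p,q\in\mathtt{P}_n$, represent $p$ and $q$ by graphs on their two rows of nodes whose connected components are the parts, stack $p$ above $q$ identifying lower node $i'$ of $p$ with upper node $i$ of $q$, and set $pq=\delta^{c}\,r$, where $r\in\mathtt{P}_n$ is the partition of the top row of $p$ and the bottom row of $q$ induced by connected components of the stacked graph, and $c$ is the number of connected components meeting neither the top row nor the bottom row. $2$-tonal (even) partition algebra: $P^2_n(\delta)$ is the subalgebra of $P_n(\delta)$ spanned by the set $\mathtt{P}^2_n$ of those $p\in\mathtt{P}_n$ such that in every part the number of upper nodes minus the number of lower nodes is even (equivalently, every part has even size). *)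

(* Defs.v *)
From HB Require Import structures.
From mathcomp Require Import all_boot all_order all_algebra all_field.

Set Implicit Arguments.
Unset Strict Implicit.
Unset Printing Implicit Defensive.

Import GRing.Theory.

Local Open Scope ring_scope.

(* [inl i] is the upper node i and [inr i] is the lower node i'. *)
Notation node n := ('I_n + 'I_n)%type.

Record diagram (n : nat) := Diagram {
  parts :> {set {set node n}};
  partsP : partition parts [set: node n] }.

HB.instance Definition _ (n : nat) := [isSub for @parts n].
HB.instance Definition _ (n : nat) := [Finite of diagram n by <:].

(* The three rows of two stacked diagrams: [inl (inl i)] is the top row,
   [inl (inr i)] the identified middle row, and [inr i] the bottom row. *)
Notation stack_node n := ('I_n + 'I_n + 'I_n)%type.

Definition of_upper (n : nat) (x : node n) : stack_node n := inl x.

Definition of_lower (n : nat) (x : node n) : stack_node n :=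
  match x with inl i => inl (inr i) | inr i => inr i end.

Definition of_outer (n : nat) (x : node n) : stack_node n :=
  match x with inl i => inl (inl i) | inr i => inr i end.

(* Each part is drawn as a complete graph. *)
Definition stack_edge (n : nat) (p q : diagram n) : rel (stack_node n) :=
  fun x y =>
    [exists B in parts p, (x \in @of_upper n @: B) && (y \in @of_upper n @: B)]
 || [exists B in parts q, (x \in @of_lower n @: B) && (y \in @of_lower n @: B)].

Definition stack_components (n : nat) (p q : diagram n) :
    {set {set stack_node n}} :=
  equivalence_partition (connect (stack_edge p q)) [set: stack_node n].

Definition closed_components (n : nat) (p q : diagram n) :
    {set {set stack_node n}} :=
  [set K in stack_components p q | [disjoint K & codom (@of_outer n)]].

Definition loops (n : nat) (p q : diagram n) : nat :=
  #|closed_components p q|.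

Definition compose_parts (n : nat) (p q : diagram n) : {set {set node n}} :=
  equivalence_partition
    (fun x y => connect (stack_edge p q) (of_outer x) (of_outer y))
    [set: node n].

Lemma stack_edge_sym (n : nat) (p q : diagram n) : symmetric (stack_edge p q).
Proof.
by move=> x y; congr orb; apply: eq_existsb => B; rewrite [X in _ && X]andbC.
Qed.

Lemma stack_connect_equiv (n : nat) (p q : diagram n) :
  equivalence_rel (connect (stack_edge p q)).
Proof.
move=> x y z; split=> [|xy]; first exact: connect0.
exact: (same_connect (sym_connect_sym (stack_edge_sym p q)) xy).
Qed.

Lemma compose_partsP (n : nat) (p q : diagram n) :
  partition (compose_parts p q) [set: node n].
Proof.
apply: equivalence_partitionP => x y z _ _ _.
exact: (stack_connect_equiv p q (of_outer x) (of_outer y) (of_outer z)).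
Qed.

Definition compose (n : nat) (p q : diagram n) : diagram n :=
  Diagram (compose_partsP p q).

Definition id_parts (n : nat) : {set {set node n}} :=
  [set [set inl i; inr i] | i : 'I_n].

Lemma id_partsP (n : nat) : partition (id_parts n) [set: node n].
Proof.
apply/and3P; split.
- apply/eqP/setP=> x; rewrite inE; apply/bigcupP.
  by case: x => i; exists [set inl i; inr i];
    rewrite ?inE ?eqxx ?orbT //; apply: imset_f.
- apply/trivIsetP=> _ _ /imsetP[i _ ->] /imsetP[j _ ->] neq.
  have ij : i != j by apply: contraNneq neq => ->.
  rewrite -setI_eq0; apply/eqP/setP=> -[k|k]; rewrite !inE; apply/negP.
  + case/andP=> /orP[/eqP[->]|//] /orP[/eqP[E]|//].
    by rewrite E eqxx in ij.
  + case/andP=> /orP[//|/eqP[->]] /orP[//|/eqP[E]].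
    by rewrite E eqxx in ij.
- apply/negP=> /imsetP[i _ /setP/(_ (inl i))].
  by rewrite !inE eqxx.
Qed.

Definition id_diagram (n : nat) : diagram n := Diagram (id_partsP n).

(* Associativity is deduced from the following observation: the 0/1 matrix
   indexed by the sets f of upper and g of lower nodes, with entry 1 when the
   union of f and g is a union of parts of p, determines p and turns composition
   into matrix product, up to the factor 2 ^ loops. *)

Definition row_union (n : nat) (f g : {set 'I_n}) : {set node n} :=
  [set x | match x with inl i => i \in f | inr i => i \in g end].

Definition saturated (n : nat) (p : diagram n) (f g : {set 'I_n}) : bool :=
  [forall B in parts p, (B \subset row_union f g) || [disjoint B & row_union f g]].

Lemma same_part_pblock (n : nat) (p : diagram n) x y :
  (y \in pblock p x) = [exists B in parts p, (x \in B) && (y \in B)].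
Proof.
have [/eqP cov triv _] := and3P (partsP p).
apply/idP/existsP=> [yx|[B /and3P[pB Bx By]]]; last by rewrite (def_pblock triv pB Bx).
by exists (pblock p x); rewrite yx mem_pblock pblock_mem cov inE.
Qed.

Lemma saturatedP (n : nat) (p : diagram n) f g :
  reflect (forall x y, y \in pblock p x ->
             (x \in row_union f g) = (y \in row_union f g))
          (saturated p f g).
Proof.
apply: (iffP forallP) => [sat x y|sat B].
  rewrite same_part_pblock => /existsP[B /and3P[pB Bx By]].
  have := sat B; rewrite pB /= => /orP[sub|dis].
    by rewrite !(subsetP sub).
  by rewrite !(disjointFr dis).
apply/implyP=> pB.
have [->|[x Bx]] := set_0Vmem B; first by rewrite sub0set.
have same y : y \in B -> (y \in row_union f g) = (x \in row_union f g).
  move=> By; apply/esym/sat; rewrite same_part_pblock.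
  by apply/existsP; exists B; rewrite pB Bx By.
case xU: (x \in row_union f g).
  by apply/orP; left; apply/subsetP=> y By; rewrite same.
apply/orP; right; rewrite disjoint_subset.
by apply/subsetP=> y By; rewrite inE same // xU.
Qed.

Lemma row_union_rows (n : nat) (X : {set node n}) :
  exists f g, X = row_union f g.
Proof.
exists [set i | inl i \in X], [set i | inr i \in X].
by apply/setP=> -[i|i]; rewrite !inE.
Qed.

Lemma saturated0 (n : nat) (p : diagram n) : saturated p set0 set0.
Proof. by apply/saturatedP=> -[i|i] [j|j] _; rewrite !inE. Qed.

Lemma part_saturated (n : nat) (p : diagram n) B f g :
  B \in parts p -> B = row_union f g -> saturated p f g.
Proof.
move=> pB defB; apply/saturatedP=> x y; rewrite -defB same_part_pblock.
have [_ triv _] := and3P (partsP p).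
case/existsP=> C /and3P[pC Cx Cy].
have sameB z : z \in C -> z \in B -> B = C.
  by move=> Cz Bz; rewrite -(def_pblock triv pB Bz) (def_pblock triv pC Cz).
by apply/idP/idP => Bz; [rewrite (sameB x)|rewrite (sameB y)].
Qed.

Lemma saturated_inj (n : nat) (p q : diagram n) :
  saturated p =2 saturated q -> p = q.
Proof.
have half (r s : diagram n) : saturated r =2 saturated s ->
    forall x y, y \in pblock r x -> y \in pblock s x.
  move=> E x y rxy; have [/eqP cov _ _] := and3P (partsP s).
  have sB : pblock s x \in parts s by rewrite pblock_mem ?cov ?inE.
  have [f [g defB]] := row_union_rows (pblock s x).
  have := part_saturated sB defB; rewrite -E => /saturatedP/(_ x y rxy).
  by rewrite -defB mem_pblock cov inE.
move=> E; apply/val_inj; rewrite /=.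
rewrite -(equivalence_partition_pblock (partsP p)).
rewrite -(equivalence_partition_pblock (partsP q)).
apply: eq_imset => x; apply/setP=> y; rewrite !inE /=.
by apply/idP/idP; apply: half => // f g; rewrite E.
Qed.

(* [f], [g] and [h] are sets of nodes of the top, middle and bottom rows. *)
Definition stack_union (n : nat) (f g h : {set 'I_n}) : {set stack_node n} :=
  [set x | match x with
           | inl (inl i) => i \in f | inl (inr i) => i \in g | inr i => i \in h
           end].

Lemma of_upper_union (n : nat) (f g h : {set 'I_n}) x :
  (of_upper x \in stack_union f g h) = (x \in row_union f g).
Proof. by case: x => i; rewrite !inE. Qed.

Lemma of_lower_union (n : nat) (f g h : {set 'I_n}) x :
  (of_lower x \in stack_union f g h) = (x \in row_union g h).
Proof. by case: x => i; rewrite !inE. Qed.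

Lemma of_outer_union (n : nat) (f g h : {set 'I_n}) x :
  (of_outer x \in stack_union f g h) = (x \in row_union f h).
Proof. by case: x => i; rewrite !inE. Qed.

Lemma saturated_stackP (n : nat) (p q : diagram n) f g h :
  reflect (forall x y, connect (stack_edge p q) x y ->
             (x \in stack_union f g h) = (y \in stack_union f g h))
          (saturated p f g && saturated q g h).
Proof.
apply: (iffP andP) => [[/saturatedP satp /saturatedP satq]|sat].
  apply: (@closed_connect _ _ (mem (stack_union f g h))) => u v /orP[].
    case/existsP=> B /and3P[pB /imsetP[x Bx ->] /imsetP[y By ->]].
    rewrite !of_upper_union; apply: satp; rewrite same_part_pblock.
    by apply/existsP; exists B; rewrite pB Bx.
  case/existsP=> B /and3P[pB /imsetP[x Bx ->] /imsetP[y By ->]].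
  rewrite !of_lower_union; apply: satq; rewrite same_part_pblock.
  by apply/existsP; exists B; rewrite pB Bx.
split; apply/saturatedP=> x y; rewrite same_part_pblock => /existsP[B /and3P[pB Bx By]].
  rewrite -!(of_upper_union f g h); apply/sat/connect1/orP; left.
  by apply/existsP; exists B; rewrite pB !imset_f.
rewrite -!(of_lower_union f g h); apply/sat/connect1/orP; right.
by apply/existsP; exists B; rewrite pB !imset_f.
Qed.

Lemma compose_pblock (n : nat) (p q : diagram n) x y :
  (y \in pblock (compose p q) x)
  = connect (stack_edge p q) (of_outer x) (of_outer y).
Proof.
rewrite pblock_equivalence_partition ?inE // => u v w _ _ _.
exact: (stack_connect_equiv p q (of_outer u) (of_outer v) (of_outer w)).
Qed.

Lemma saturated_compose_aux (n : nat) (p q : diagram n) f g h :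
  saturated p f g && saturated q g h -> saturated (compose p q) f h.
Proof.
move=> /saturated_stackP sat; apply/saturatedP=> x y.
by rewrite compose_pblock => /sat; rewrite !of_outer_union.
Qed.

Section CountMiddle.
Variables (n : nat) (p q : diagram n) (f h : {set 'I_n}).
Local Notation conn := (connect (stack_edge p q)).
Local Notation CC := (closed_components p q).

Let connC x y : conn x y = conn y x.
Proof. exact/sym_connect_sym/stack_edge_sym. Qed.

Let mid (i : 'I_n) : stack_node n := inl (inr i).

Let mid_outer (x : stack_node n) :
  (exists i, x = mid i) \/ (exists y, x = of_outer y).
Proof.
case: x => [[i|i]|i]; [right|left|right].
- by exists (inl i).
- by exists i.
- by exists (inr i).
Qed.

Let outer_codom y : of_outer y \in codom (@of_outer n).
Proof. exact: codom_f. Qed.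

Let meets (x : stack_node n) :=
  [exists y, (y \in row_union f h) && conn x (of_outer y)].

Let fill (S : {set {set stack_node n}}) : {set 'I_n} :=
  [set i | meets (mid i) || (mid i \in cover S)].

Let CC_conn (K : {set stack_node n}) x y : K \in CC -> x \in K -> (y \in K) = conn x y.
Proof.
rewrite inE => /andP[/imsetP[z _ ->] _]; rewrite !inE /= => zx.
exact: (same_connect (sym_connect_sym (stack_edge_sym p q))).
Qed.

Let CC_mid (K : {set stack_node n}) x : K \in CC -> x \in K -> exists i, x = mid i.
Proof.
move=> KC Kx; have [//|[y xy]] := mid_outer x; move: KC.
by rewrite inE => /andP[_ /disjointFr/(_ Kx)]; rewrite xy outer_codom.
Qed.

Let CC_outer (K : {set stack_node n}) x y : K \in CC -> x \in K -> ~~ conn x (of_outer y).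
Proof.
move=> KC Kx; rewrite -(CC_conn _ KC Kx); apply/negP=> /(CC_mid KC)[i].
by case: y.
Qed.

Let CC_ne (K : {set stack_node n}) : K \in CC -> exists x, x \in K.
Proof.
by rewrite inE => /andP[/imsetP[z _ ->] _]; exists z; rewrite !inE connect0.
Qed.

Let CC_class x : (forall y, ~~ conn x (of_outer y)) ->
  [set y in [set: stack_node n] | conn x y] \in CC.
Proof.
move=> no; rewrite inE; apply/andP; split; first by apply: imset_f.
rewrite disjoint_subset; apply/subsetP=> z; rewrite !inE /= => xz.
by apply/codomP=> -[y zy]; rewrite zy (negbTE (no y)) in xz.
Qed.

Let stack_fill (S : {set {set stack_node n}}) x : saturated (compose p q) f h -> S \subset CC ->
  (x \in stack_union f (fill S) h) = meets x || (x \in cover S).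
Proof.
move=> /saturatedP sat sS.
case: (mid_outer x) => [[i ->]|[y ->]]; first by rewrite inE /= inE.
rewrite of_outer_union; apply/idP/orP=> [yfh|[/existsP[z /andP[zfh yz]]|]].
- by left; apply/existsP; exists y; rewrite yfh connect0.
- by rewrite (sat y z) // compose_pblock.
- case/bigcupP=> K SK Ky; have KC := subsetP sS _ SK.
  by have [i] := CC_mid KC Ky; case: (y).
Qed.

Let fill_sat (S : {set {set stack_node n}}) : saturated (compose p q) f h -> S \subset CC ->
  saturated p f (fill S) && saturated q (fill S) h.
Proof.
move=> sat sS; apply/saturated_stackP=> x y xy; rewrite !stack_fill //.
congr orb.
  apply: eq_existsb => z; congr andb.
  exact: (same_connect (sym_connect_sym (stack_edge_sym p q))).
apply/bigcupP/bigcupP=> -[K SK Kz]; exists K => //; have KC := subsetP sS _ SK.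
  by rewrite (CC_conn _ KC Kz).
by rewrite (CC_conn _ KC Kz) connC.
Qed.

Let fill_inj (S : {set {set stack_node n}}) : S \subset CC -> S = [set K in CC | K \subset @mid @: fill S].
Proof.
move=> sS; apply/setP=> K; rewrite inE; apply/idP/andP=> [SK|[KC]].
  have KC := subsetP sS _ SK; split=> //; apply/subsetP=> x Kx.
  have [i xi] := CC_mid KC Kx; rewrite xi imset_f // inE -xi.
  by apply/orP; right; apply/bigcupP; exists K.
move=> sub; have [x Kx] := CC_ne KC.
have /imsetP[i] := subsetP sub _ Kx; rewrite inE => iS xi; rewrite xi in Kx.
case/orP: iS => [/existsP[y /andP[_]]|/bigcupP[L SL Li]].
  by rewrite (negbTE (CC_outer _ KC Kx)).
have LC := subsetP sS _ SL.
suff -> : K = L by [].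
by apply/setP=> y; rewrite (CC_conn _ KC Kx) (CC_conn _ LC Li).
Qed.

Let fill_surj g : saturated p f g && saturated q g h ->
  exists2 S : {set {set stack_node n}}, S \subset CC & g = fill S.
Proof.
move=> satg; have /saturated_stackP sat := satg.
have satc := saturated_compose_aux satg.
exists [set K in CC | K \subset stack_union f g h].
  by apply/subsetP=> K; rewrite inE => /andP[].
set S := [set K in CC | _].
apply/setP=> i; rewrite inE.
have -> : (i \in g) = (mid i \in stack_union f g h) by rewrite inE.
apply/idP/orP=> [gi|[/existsP[y /andP[yfh iy]]|/bigcupP[K]]].
- case: (boolP [exists y, conn (mid i) (of_outer y)]) => [/existsP[y iy]|].
    left; apply/existsP; exists y; rewrite iy andbT.
    by rewrite -(of_outer_union f g h) -(sat _ _ iy).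
  rewrite negb_exists => /forallP no; right; apply/bigcupP.
  exists [set y in [set: stack_node n] | conn (mid i) y]; last first.
    by rewrite !inE connect0.
  rewrite inE CC_class //=; apply/subsetP=> y; rewrite inE => /andP[_ iy].
  by rewrite -(sat _ _ iy).
- by rewrite (sat _ _ iy) of_outer_union.
- by rewrite inE => /andP[_ /subsetP]; apply.
Qed.

Lemma count_middle :
  #|[set g | saturated p f g && saturated q g h]|
  = (2 ^ loops p q * saturated (compose p q) f h)%N.
Proof.
case: (boolP (saturated (compose p q) f h)) => [satc|/negP nsat]; last first.
  rewrite muln0; apply/eqP; rewrite cards_eq0; apply/eqP/setP=> g.
  by rewrite !inE; apply/negP=> /saturated_compose_aux.
rewrite muln1 /loops -card_powerset.
have -> : [set g | saturated p f g && saturated q g h] = fill @: powerset CC.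
  apply/setP=> g; rewrite inE; apply/idP/imsetP=> [/fill_surj[S sS ->]|[S]].
    by exists S => //; rewrite inE.
  by rewrite inE => sS ->; apply: fill_sat.
apply: card_in_imset => S S'; rewrite !inE => sS sS' E.
by rewrite (fill_inj sS) (fill_inj sS') E.
Qed.

End CountMiddle.

Lemma sum_saturated (n : nat) (p q : diagram n) (f h : {set 'I_n}) :
  (\sum_(g : {set 'I_n}) saturated p f g * saturated q g h
   = 2 ^ loops p q * saturated (compose p q) f h)%N.
Proof.
rewrite -count_middle -sum1_card [RHS]big_mkcond /=; apply: eq_bigr => g _.
by rewrite inE; case: (saturated p f g); case: (saturated q g h).
Qed.

Lemma compose_loopsA (n : nat) (p q r : diagram n) :
  compose p (compose q r) = compose (compose p q) r
  /\ (loops q r + loops p (compose q r) = loops p q + loops (compose p q) r)%N.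
Proof.
have E f l : (2 ^ (loops q r + loops p (compose q r))
                 * saturated (compose p (compose q r)) f l
              = 2 ^ (loops p q + loops (compose p q) r)
                 * saturated (compose (compose p q) r) f l)%N.
  rewrite !expnD -!mulnA -!sum_saturated !big_distrr /=.
  transitivity (\sum_g \sum_h
     saturated p f g * (saturated q g h * saturated r h l))%N.
    by apply: eq_bigr => g _; rewrite mulnCA -sum_saturated big_distrr.
  rewrite exchange_big; apply: eq_bigr => h _ /=.
  rewrite mulnA -sum_saturated big_distrl; apply: eq_bigr => g _ /=.
  by rewrite mulnA.
have L : (loops q r + loops p (compose q r)
          = loops p q + loops (compose p q) r)%N.
  have := E set0 set0; rewrite !saturated0 !muln1.
  by move/eqP; rewrite eqn_exp2l // => /eqP.
split=> //; apply: saturated_inj => f l; have := E f l; rewrite L.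
move/eqP; rewrite eqn_pmul2l ?expn_gt0 //.
by case: (saturated _ f l); case: (saturated _ f l).
Qed.

Lemma saturated_id (n : nat) (f g : {set 'I_n}) :
  saturated (id_diagram n) f g = (f == g).
Proof.
apply/saturatedP/eqP=> [sat|-> x y].
  apply/setP=> i; have := sat (inl i) (inr i); rewrite !inE; apply.
  rewrite same_part_pblock; apply/existsP; exists [set inl i; inr i].
  by rewrite !inE !eqxx !andbT; apply: imset_f.
rewrite same_part_pblock => /existsP[_ /and3P[/imsetP[i _ ->]]].
by rewrite !inE => /orP[]/eqP-> /orP[]/eqP->.
Qed.

Lemma compose_loops1 (n : nat) (p : diagram n) :
  (compose (id_diagram n) p = p /\ loops (id_diagram n) p = 0)
  * (compose p (id_diagram n) = p /\ loops p (id_diagram n) = 0).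
Proof.
have El f h : (2 ^ loops (id_diagram n) p * saturated (compose (id_diagram n) p) f h
   = saturated p f h)%N.
  rewrite -sum_saturated (bigD1 f) //= saturated_id eqxx mul1n big1 ?addn0 // => g.
  by rewrite saturated_id eq_sym => /negbTE->.
have Er f h : (2 ^ loops p (id_diagram n) * saturated (compose p (id_diagram n)) f h
   = saturated p f h)%N.
  rewrite -sum_saturated (bigD1 h) //= saturated_id eqxx muln1 big1 ?addn0 // => g.
  by rewrite saturated_id => /negbTE->; rewrite muln0.
have Ll : loops (id_diagram n) p = 0.
  by have := El set0 set0; rewrite !saturated0 muln1; case: (loops _ _) => // k;
     rewrite expnS; case: (2 ^ k)%N => // m; rewrite mulnS.
have Lr : loops p (id_diagram n) = 0.
  by have := Er set0 set0; rewrite !saturated0 muln1; case: (loops _ _) => // k;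
     rewrite expnS; case: (2 ^ k)%N => // m; rewrite mulnS.
split; split=> //; apply: saturated_inj => f h.
  by have := El f h; rewrite Ll mul1n; do 2!case: (saturated _ _ _).
by have := Er f h; rewrite Lr mul1n; do 2!case: (saturated _ _ _).
Qed.

(* [f : partition_algebra n delta] is the linear combination of the diagrams p
   with coefficients [f p]; [delta] only enters through the product. *)
Definition partition_algebra (K : fieldType) (n : nat) (delta : K) : Type :=
  {ffun diagram n -> K^o}.

HB.instance Definition _ (K : fieldType) (n : nat) (delta : K) :=
  Vector.copy (partition_algebra n delta) {ffun diagram n -> K^o}.

Definition diagram_vec (K : fieldType) (n : nat) (delta : K) (p : diagram n) :
    partition_algebra n delta :=
  [ffun q => (q == p)%:R : K^o].

Section Algebra.
Variables (K : fieldType) (n : nat) (delta : K).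
Local Notation A := (partition_algebra n delta).
Local Notation e := (@diagram_vec K n delta).

Definition partition_one : A := e (id_diagram n).

Definition partition_mul (f g : A) : A :=
  \sum_p \sum_q (f p * g q * delta ^+ loops p q) *: e (compose p q).

Lemma partition_coefD (f g : A) p : (f + g) p = f p + g p.
Proof. exact: ffunE. Qed.

Lemma partition_coefZ a (f : A) p : (a *: f) p = a * f p.
Proof. exact: ffunE. Qed.

Lemma partition_mulDl : left_distributive partition_mul +%R.
Proof.
move=> f f' g; rewrite -big_split; apply: eq_bigr => p _.
rewrite -big_split; apply: eq_bigr => q _ /=.
by rewrite partition_coefD -scalerDl !mulrDl.
Qed.

Lemma partition_mulDr : right_distributive partition_mul +%R.
Proof.
move=> f g g'; rewrite -big_split; apply: eq_bigr => p _.
rewrite -big_split; apply: eq_bigr => q _ /=.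
by rewrite partition_coefD -scalerDl mulrDr mulrDl.
Qed.

Lemma partition_mulZl a (f g : A) :
  partition_mul (a *: f) g = a *: partition_mul f g.
Proof.
rewrite scaler_sumr; apply: eq_bigr => p _.
rewrite scaler_sumr; apply: eq_bigr => q _.
by rewrite partition_coefZ scalerA !mulrA.
Qed.

Lemma partition_mulZr a (f g : A) :
  partition_mul f (a *: g) = a *: partition_mul f g.
Proof.
rewrite scaler_sumr; apply: eq_bigr => p _.
rewrite scaler_sumr; apply: eq_bigr => q _.
by rewrite partition_coefZ scalerA mulrCA !mulrA.
Qed.

Lemma partition_mul_suml (I : finType) (F : I -> A) g :
  partition_mul (\sum_i F i) g = \sum_i partition_mul (F i) g.
Proof.
apply: (big_morph (partition_mul^~ g)) => [f f'|]; first exact: partition_mulDl.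
by have := partition_mulZl 0 0 g; rewrite !scale0r.
Qed.

Lemma partition_mul_sumr (I : finType) (F : I -> A) f :
  partition_mul f (\sum_i F i) = \sum_i partition_mul f (F i).
Proof.
apply: (big_morph (partition_mul f)) => [g g'|]; first exact: partition_mulDr.
by have := partition_mulZr 0 f 0; rewrite !scale0r.
Qed.

Lemma diagram_vec_mul p q :
  partition_mul (e p) (e q) = delta ^+ loops p q *: e (compose p q).
Proof.
rewrite /partition_mul (bigD1 p) //= [X in _ + X]big1 => [|p' /negbTE np].
  rewrite addr0 (bigD1 q) //= [X in _ + X]big1 => [|q' /negbTE nq].
    by rewrite addr0 !ffunE !eqxx !mul1r.
  by rewrite !ffunE nq mulr0 mul0r scale0r.
by apply: big1 => q' _; rewrite !ffunE np !mul0r scale0r.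
Qed.

Lemma diagram_vec_sum (f : A) : f = \sum_p f p *: e p.
Proof.
apply/ffunP=> q; rewrite sum_ffunE (bigD1 q) //= partition_coefZ ffunE eqxx mulr1.
rewrite big1 ?addr0 // => p /negbTE np.
by rewrite partition_coefZ ffunE eq_sym np mulr0.
Qed.

Lemma partition_mulA : associative partition_mul.
Proof.
have suml := partition_mul_suml; have sumr := partition_mul_sumr.
have Zl := partition_mulZl; have Zr := partition_mulZr.
have mul_e := diagram_vec_mul.
(* Generalized to keep [rewrite] from unfolding it. *)
move: partition_mul suml sumr Zl Zr mul_e => mul suml sumr Zl Zr mul_e f g h.
rewrite [f]diagram_vec_sum !suml; apply: eq_bigr => p _.
rewrite !Zl; congr (_ *: _).
rewrite [g]diagram_vec_sum !(suml, sumr); apply: eq_bigr => q _.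
rewrite !(Zl, Zr); congr (_ *: _).
rewrite [h]diagram_vec_sum !sumr; apply: eq_bigr => r _.
rewrite !Zr; congr (_ *: _).
rewrite !mul_e Zl Zr !mul_e !scalerA -!exprD.
by have [-> ->] := compose_loopsA p q r.
Qed.

Lemma partition_mul1l : left_id partition_one partition_mul.
Proof.
move=> f; rewrite {1}[f]diagram_vec_sum partition_mul_sumr [RHS]diagram_vec_sum.
apply: eq_bigr => p _; rewrite partition_mulZr diagram_vec_mul.
by have [[-> ->] _] := compose_loops1 p; rewrite scale1r.
Qed.

Lemma partition_mul1r : right_id partition_one partition_mul.
Proof.
move=> f; rewrite {1}[f]diagram_vec_sum partition_mul_suml [RHS]diagram_vec_sum.
apply: eq_bigr => p _; rewrite partition_mulZl diagram_vec_mul.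
by have [_ [-> ->]] := compose_loops1 p; rewrite scale1r.
Qed.

Lemma partition_one_neq0 : partition_one != 0.
Proof.
apply/eqP=> /ffunP/(_ (id_diagram n)); rewrite !ffunE eqxx => /eqP.
by rewrite oner_eq0.
Qed.

HB.instance Definition _ := GRing.Zmodule_isNzRing.Build A
  partition_mulA partition_mul1l partition_mul1r partition_mulDl partition_mulDr
  partition_one_neq0.

Lemma partition_scaleAl (a : K) (f g : A) : a *: (f * g) = a *: f * g.
Proof. by rewrite [RHS]partition_mulZl. Qed.

Lemma partition_scaleAr (a : K) (f g : A) : a *: (f * g) = f * (a *: g).
Proof. by rewrite [RHS]partition_mulZr. Qed.

HB.instance Definition _ := GRing.Lmodule_isLalgebra.Build K A partition_scaleAl.
HB.instance Definition _ := GRing.Lalgebra_isAlgebra.Build K A partition_scaleAr.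
HB.instance Definition _ := Algebra_isFalgebra.Build K A.

End Algebra.

Definition upper_nodes (n : nat) (B : {set node n}) : {set 'I_n} :=
  [set i | inl i \in B].

Definition lower_nodes (n : nat) (B : {set node n}) : {set 'I_n} :=
  [set i | inr i \in B].

Definition two_tonal (n : nat) (p : diagram n) : bool :=
  [forall B in parts p, (2 %| #|upper_nodes B|%:Z - #|lower_nodes B|%:Z)%Z].

Lemma dvd2_subz (a b : nat) : (2 %| a%:Z - b%:Z)%Z = ~~ odd (a + b).
Proof.
have -> : a%:Z - b%:Z = (a + b)%N%:Z - b%:Z * 2.
  by rewrite PoszD mulrDr !mulr1 opprD addrA addrK.
by rewrite rpredBr ?dvdz_mull // dvdzE /= dvdn2.
Qed.

Lemma two_tonal_part (n : nat) (B : {set node n}) :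
  (2 %| #|upper_nodes B|%:Z - #|lower_nodes B|%:Z)%Z = ~~ odd #|B|.
Proof.
have -> : #|B| = (#|upper_nodes B| + #|lower_nodes B|)%N.
  rewrite -(card_imset _ (@inl_inj 'I_n 'I_n)) -(card_imset _ (@inr_inj 'I_n 'I_n)).
  rewrite -cardsUI.
  have -> : (inl @: upper_nodes B : {set node n}) :&: inr @: lower_nodes B = set0.
    by apply/setP=> x; rewrite !inE; apply/andP=> -[/imsetP[i _ ->] /imsetP[]].
  rewrite cards0 addn0.
  congr #|pred_of_set _|; apply/setP=> -[i|i]; rewrite !inE.
    rewrite mem_imset ?inE; last exact: inl_inj.
    by case: imsetP => [[]|_]; rewrite ?orbF.
  rewrite [X in _ || X]mem_imset ?inE; last exact: inr_inj.
  by case: imsetP => [[]|_].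
by rewrite dvd2_subz.
Qed.

Lemma row_union_card (n : nat) (f g : {set 'I_n}) :
  ~~ odd #|row_union f g| = (odd #|f| == odd #|g|).
Proof.
have uf : upper_nodes (row_union f g) = f by apply/setP=> i; rewrite !inE.
have lg : lower_nodes (row_union f g) = g by apply/setP=> i; rewrite !inE.
rewrite -two_tonal_part uf lg dvd2_subz oddD.
by case: (odd _); case: (odd _).
Qed.

Lemma two_tonal_saturated (n : nat) (p : diagram n) :
  reflect (forall f g, saturated p f g -> odd #|f| = odd #|g|) (two_tonal p).
Proof.
apply: (iffP forallP) => [tp f g /forallP sat|tp B]; last first.
  apply/implyP=> pB; rewrite two_tonal_part.
  have [f [g defB]] := row_union_rows B.
  by rewrite defB row_union_card; apply/eqP/tp/(part_saturated pB defB).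
apply/eqP; rewrite -row_union_card.
have [/eqP cov triv _] := and3P (partsP p).
pose Q := [set B in parts p | B \subset row_union f g].
have trivQ : trivIset Q by apply: trivIsetS triv; apply/subsetP=> B; rewrite inE => /andP[].
have -> : row_union f g = cover Q.
  apply/setP=> x; apply/idP/bigcupP=> [Ux|[B]]; last first.
    by rewrite inE => /andP[_ /subsetP]; apply.
  have xB : x \in pblock p x by rewrite mem_pblock cov inE.
  have pB : pblock p x \in parts p by rewrite pblock_mem // cov inE.
  exists (pblock p x) => //; rewrite inE pB /=.
  by have := sat (pblock p x); rewrite pB /= => /orP[//|/disjointFr/(_ xB)]; rewrite Ux.
rewrite -(eqP trivQ) /=.
elim/big_ind: _ => // [x y ex ey|B]; first by rewrite oddD (negbTE ex) (negbTE ey).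
rewrite inE => /andP[pB _]; rewrite -two_tonal_part.
by have := tp B; rewrite pB.
Qed.

Lemma two_tonal_id (n : nat) : two_tonal (id_diagram n).
Proof. by apply/two_tonal_saturated=> f g; rewrite saturated_id => /eqP->. Qed.

Lemma two_tonal_compose (n : nat) (p q : diagram n) :
  two_tonal p -> two_tonal q -> two_tonal (compose p q).
Proof.
move=> /two_tonal_saturated tp /two_tonal_saturated tq.
apply/two_tonal_saturated=> f h sat.
have: (0 < #|[set g | saturated p f g && saturated q g h]|)%N.
  by rewrite count_middle sat muln1 expn_gt0.
case/card_gt0P=> g; rewrite inE => /andP[/tp-> /tq].
exact.
Qed.

Definition two_tonal_span (K : fieldType) (n : nat) (delta : K) :
    {vspace partition_algebra n delta} :=
  <<[seq diagram_vec delta p | p : diagram n in @two_tonal n]>>%VS.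

Lemma two_tonal_span_aspace (K : fieldType) (n : nat) (delta : K) :
  is_aspace (two_tonal_span n delta).
Proof.
have mem p : two_tonal p -> diagram_vec delta p \in two_tonal_span n delta.
  by move=> tp; apply/memv_span/imageP; exists p.
apply/andP; split; first by apply/has_algid1/mem/two_tonal_id.
apply/prodvP=> u v Uu Uv.
suff /subvP/(_ u Uu) : (two_tonal_span n delta
                        <= amulr v @^-1: two_tonal_span n delta)%VS.
  by rewrite -memv_preim lfunE.
apply/span_subvP=> _ /imageP[p tp ->]; rewrite -memv_preim lfunE /=.
suff /subvP/(_ v Uv) : (two_tonal_span n delta
    <= amull (diagram_vec delta p) @^-1: two_tonal_span n delta)%VS.
  by rewrite -memv_preim lfunE.
apply/span_subvP=> _ /imageP[q tq ->]; rewrite -memv_preim lfunE /=.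
by rewrite [_ * _]diagram_vec_mul memvZ // mem // two_tonal_compose.
Qed.

Canonical two_tonal_aspace (K : fieldType) (n : nat) (delta : K) :
  {aspace partition_algebra n delta} := ASpace (two_tonal_span_aspace n delta).

Definition two_tonal_algebra (K : fieldType) (n : nat) (delta : K) : falgType K :=
  subvs_of (two_tonal_aspace n delta).

Definition left_ideal (K : fieldType) (A : falgType K) (U : {vspace A}) : Prop :=
  forall a u : A, u \in U -> a * u \in U.

Definition simple_left_ideal (K : fieldType) (A : falgType K) (U : {vspace A}) :
    Prop :=
  [/\ left_ideal U, U <> 0%VS
    & forall W : {vspace A}, left_ideal W -> (W <= U)%VS -> W = 0%VS \/ W = U].

(* The regular left module is a finite direct sum of simple submodules. *)
Definition semisimple (K : fieldType) (A : falgType K) : Prop :=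
  exists (k : nat) (S : 'I_k -> {vspace A}),
    [/\ forall i, simple_left_ideal (S i),
        directv (\sum_i S i)%VS
      & (\sum_i S i)%VS = fullv].

(* Main.v *)
(* Semisimplicity.  For p let c(p) be the number of components of the closure of
   p (upper node i joined to lower node i'), and let tau(p) = delta^(c(p) - 1), a
   trace.  The Gram matrix of (x, y) |-> tau(x y) on diagrams is
   delta^(|p \/ q^*| - 1), which factors as Z^T C Z with Z the unitriangular
   zeta matrix of the refinement order and C diagonal with entries
   (delta - 1)...(delta - |k| + 1); so it is nondegenerate when delta is not a
   positive integer.  On the other hand, every trace function psi on the two-tonal
   algebra vanishes on elements of square zero, if delta <> 0 or n is odd.
   Indeed, on the layer of diagrams with a given positive number of propagating
   parts, psi is determined modulo lower layers by its values on the diagrams all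
   of whose parts propagate, hence agrees there with a combination of the traces
   of x |-> z x h on that layer, and these vanish for z of square zero.  The layer
   without propagating parts is empty for n odd, and there psi is a multiple of
   one such trace when delta <> 0.  A nondegenerate trace vanishing on elements of
   square zero forces each minimal left ideal to be generated by an idempotent.

   Failure.  If delta = m > 0 and n = 2 (m + 1), the alternating sum x over
   w in S_(m+1) of the diagrams pairing upper nodes a and m + 1 + w(a), with all
   lower nodes in one part, satisfies x y x = 0 for all y, because the coefficients
   count colorings with m colors and reduce to determinants with two equal rows.
   If delta = 0 and n is even, the diagram with parts the two rows does this. *)

Require Import Defs.
From mathcomp Require Import all_boot all_order all_algebra all_field.
From mathcomp Require Import fingroup perm.
From mathcomp Require Import reals complex.
From mathcomp Require boolp.

Set Implicit Arguments.
Unset Strict Implicit.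
Unset Printing Implicit Defensive.

Import GRing.Theory.
Local Open Scope ring_scope.

(** * The relation of saturated sets *)

Section Relation.
Variable n : nat.
Implicit Types (p q r : diagram n) (f g h : {set 'I_n}).

(** The parts are the fibres of a labelling, so concrete diagrams can be given by a function without
    proving anything about partitions. *)
Definition label_diagram (T : eqType) (lab : node n -> T) : diagram n :=
  Diagram (preim_partitionP lab [set: node n]).

Lemma pblock_label (T : eqType) (lab : node n -> T) x y :
  (y \in pblock (label_diagram lab) x) = (lab x == lab y).
Proof.
rewrite pblock_equivalence_partition ?inE // => u v w _ _ _.
by split=> [|/eqP->].
Qed.

Lemma mem_pblock_same p x y : (y \in pblock p x) = (pblock p x == pblock p y).
Proof.
have [/eqP cov triv _] := and3P (partsP p).
by rewrite eq_pblock ?cov ?inE.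
Qed.

Lemma saturated_labelP (T : eqType) (lab : node n -> T) f g :
  reflect (forall x y, lab x = lab y ->
             (x \in row_union f g) = (y \in row_union f g))
          (saturated (label_diagram lab) f g).
Proof.
apply: (iffP (saturatedP _ _ _)) => sat x y.
  by move=> xy; apply: sat; rewrite pblock_label; apply/eqP.
by rewrite pblock_label => /eqP; apply: sat.
Qed.

Definition swap (x : node n) : node n :=
  match x with inl i => inr i | inr i => inl i end.

Lemma swapK : involutive swap.
Proof. by case. Qed.

Lemma swap_row_union f g x : (swap x \in row_union f g) = (x \in row_union g f).
Proof. by case: x => i; rewrite !inE. Qed.

(** The reflection p^* in the horizontal axis, an anti-automorphism for composition. *)
Definition flip p : diagram n := label_diagram (fun x => pblock p (swap x)).

Lemma pblock_flip p x y :
  (y \in pblock (flip p) x) = (swap y \in pblock p (swap x)).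
Proof. by rewrite pblock_label mem_pblock_same. Qed.

Lemma saturated_flip p f g : saturated (flip p) f g = saturated p g f.
Proof.
apply/saturatedP/saturatedP=> sat x y xy.
  rewrite -!(swap_row_union f g); apply: sat.
  by rewrite pblock_flip !swapK.
by rewrite -!(swap_row_union g f); apply: sat; rewrite -pblock_flip.
Qed.

Lemma flipK : involutive flip.
Proof. by move=> p; apply: saturated_inj => f g; rewrite !saturated_flip. Qed.

(** The number of admissible middle sets is a power of two or zero, hence positive exactly in the
    saturated case. Thus composing diagrams is composing relations. *)
Lemma saturated_compose p q f h :
  saturated (compose p q) f h = [exists g, saturated p f g && saturated q g h].
Proof.
apply/idP/existsP=> [sat|[g]]; last exact: saturated_compose_aux.
have: (0 < #|[set g | saturated p f g && saturated q g h]|)%N.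
  by rewrite count_middle sat muln1 expn_gt0.
by case/card_gt0P=> g; rewrite inE; exists g.
Qed.

Lemma compose_flip p q : flip (compose p q) = compose (flip q) (flip p).
Proof.
apply: saturated_inj => f g; rewrite saturated_flip !saturated_compose.
by apply: eq_existsb => h; rewrite !saturated_flip andbC.
Qed.

(** For empty outer sets, the admissible middle sets are the unions of closed components, and there
    are 2 ^ [loops p q] of them. *)
Lemma loops_eq0 p q :
  (forall g, saturated p set0 g -> saturated q g set0 -> g = set0) ->
  loops p q = 0%N.
Proof.
move=> only0; have := count_middle p q set0 set0.
have -> : [set g | saturated p set0 g && saturated q g set0] = [set set0].
  apply/setP=> g; rewrite !inE; apply/andP/eqP=> [[]|->]; first exact: only0.
  by rewrite !saturated0.
rewrite cards1 saturated0 muln1 => /esym/eqP.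
by rewrite -{2}(expn0 2) eqn_exp2l // => /eqP.
Qed.

(* The relation [saturated p] is a linear subspace over F_2; this is the only
   consequence of linearity that is used. *)
Lemma saturated_difunctional p f f' g g' :
  saturated p f g -> saturated p f' g -> saturated p f' g' -> saturated p f g'.
Proof.
move=> /saturatedP s1 /saturatedP s2 /saturatedP s3.
have E x : (x \in row_union f g') = (x \in row_union f g)
    (+) (x \in row_union f' g) (+) (x \in row_union f' g').
  by case: x => i; rewrite !inE; do !case: (_ \in _).
by apply/saturatedP=> x y xy; rewrite !E (s1 x y) // (s2 x y) // (s3 x y).
Qed.

Definition images p f : {set {set 'I_n}} := [set g | saturated p f g].

Definition domain p : {set {set 'I_n}} := [set f | [exists g, saturated p f g]].

(* This is 2 to the power of the number of propagating parts. *)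
Definition rk p : nat := #|images p @: domain p|.

Lemma domainP p f : reflect (exists g, saturated p f g) (f \in domain p).
Proof. by rewrite inE; apply: existsP. Qed.

Lemma codomainP p g : reflect (exists f, saturated p f g) (g \in domain (flip p)).
Proof.
by apply: (iffP (domainP (flip p) g)) => -[f sat];
  exists f; move: sat; rewrite saturated_flip.
Qed.

(** Each row of the composite is the image under q of a row of p, so [T] maps the rows of p onto a
    set containing the rows of the composite. *)
Lemma rk_composel p q : (rk (compose p q) <= rk p)%N.
Proof.
pose T (R : {set {set 'I_n}}) := [set h | [exists g in R, saturated q g h]].
apply: leq_trans (leq_imset_card T _); apply/subset_leq_card/subsetP=> _ /imsetP[f /domainP[h] + ->].
rewrite saturated_compose => /existsP[g /andP[fg gh]].
apply/imsetP; exists (images p f); first by apply/imset_f/domainP; exists g.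
apply/setP=> k; rewrite !inE saturated_compose.
by apply: eq_existsb => g'; rewrite inE.
Qed.

(** By difunctionality, intersecting the rows at the elements of a column gives back a row, and
    every row arises so. *)
Lemma rk_flip_le p : (rk p <= rk (flip p))%N.
Proof.
pose T (R : {set {set 'I_n}}) := \bigcap_(f in R) images p f.
apply: leq_trans (leq_imset_card T _); apply/subset_leq_card/subsetP=> _ /imsetP[f /domainP[g fg] ->].
apply/imsetP; exists (images (flip p) g).
  by apply/imset_f/domainP; exists f; rewrite saturated_flip.
apply/setP=> h; rewrite inE; apply/idP/bigcapP=> [fh f'|].
  rewrite !inE saturated_flip => f'g; exact: saturated_difunctional fg fh.
by move/(_ f); rewrite !inE saturated_flip; apply.
Qed.

Lemma rk_flip p : rk (flip p) = rk p.
Proof. by apply/eqP; rewrite eqn_leq rk_flip_le -{2}[p]flipK rk_flip_le. Qed.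

Lemma rk_composer p q : (rk (compose p q) <= rk q)%N.
Proof. by rewrite -rk_flip compose_flip -[rk q]rk_flip rk_composel. Qed.

Lemma rk_le_domain p : (rk p <= #|domain p|)%N.
Proof. exact: leq_imset_card. Qed.

(* Equivalently, no part is contained in the upper row. *)
Definition upper_inj p : bool := rk p == #|domain p|.

(** Equality of cardinals means that distinct elements of the domain have distinct rows; by
    difunctionality, rows with a common element coincide. *)
Lemma upper_injP p :
  reflect (forall f f' g, saturated p f g -> saturated p f' g -> f = f')
          (upper_inj p).
Proof.
rewrite /upper_inj /rk; apply: (iffP imset_injP) => inj.
  move=> f f' g fg f'g; apply: inj; try by apply/domainP; exists g.
  apply/setP=> h; rewrite !inE; apply/idP/idP.
    exact: saturated_difunctional f'g fg.
  exact: saturated_difunctional fg f'g.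
move=> f f' /domainP[g fg] _ /setP/(_ g); rewrite !inE fg => /esym.
exact: inj.
Qed.

Lemma lower_injP p :
  reflect (forall f g g', saturated p f g -> saturated p f g' -> g = g')
          (upper_inj (flip p)).
Proof.
apply: (iffP (upper_injP _)) => inj f g g'.
  by rewrite -!(saturated_flip p); apply: inj.
by rewrite !saturated_flip; apply: inj.
Qed.

(* Block bijections: every part is propagating. *)
Definition block_bij p : bool := upper_inj p && upper_inj (flip p).

Lemma block_bij_flip p : block_bij (flip p) = block_bij p.
Proof. by rewrite /block_bij flipK andbC. Qed.

Lemma card_domain_bij p : block_bij p -> #|domain p| = rk p.
Proof. by case/andP=> /eqP. Qed.

Lemma domain_composel p q : domain (compose p q) \subset domain p.
Proof.
apply/subsetP=> f /domainP[h]; rewrite saturated_compose => /existsP[g /andP[fg _]].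
by apply/domainP; exists g.
Qed.

Lemma codomain_composer p q :
  domain (flip (compose p q)) \subset domain (flip q).
Proof. by rewrite compose_flip domain_composel. Qed.

(** No part of p lies inside its lower row, so every component through the middle row reaches the
    top. *)
Lemma loops_lower_inj p q : upper_inj (flip p) -> loops p q = 0%N.
Proof.
move/lower_injP=> inj; apply: loops_eq0 => g pg _.
exact: inj pg (saturated0 p).
Qed.

Lemma loops_upper_inj p q : upper_inj q -> loops p q = 0%N.
Proof.
move/upper_injP=> inj; apply: loops_eq0 => g _ qg.
exact: inj qg (saturated0 q).
Qed.

Lemma two_tonal_flip p : two_tonal p -> two_tonal (flip p).
Proof.
move/two_tonal_saturated=> tp; apply/two_tonal_saturated=> f g.
by rewrite saturated_flip => /tp.
Qed.

End Relation.

(** * Factorization through block bijections, and their groupoid structure *)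

Section Factor.
Variable n : nat.
Implicit Types (p q r s a b g h : diagram n) (f x y : {set 'I_n}).

Lemma rk_gt0 p : (0 < rk p)%N.
Proof.
by rewrite /rk; apply/card_gt0P; exists (images p set0); apply/imset_f/domainP; exists set0; rewrite saturated0.
Qed.

(** With only one row, the relation is a product of its domain and codomain; this is the case of no
    propagating parts. *)
Lemma rk1_product p f f' x x' :
  rk p = 1%N -> saturated p f x -> saturated p f' x' -> saturated p f x'.
Proof.
move/eqP/cards1P=> [R rowsE] fx fx'.
have row_eq u v : saturated p u v -> images p u = R.
  move=> uv; apply/set1P; rewrite -rowsE; apply: imset_f.
  by apply/domainP; exists v.
by have := row_eq _ _ fx; rewrite -(row_eq _ _ fx') => /setP/(_ x'); rewrite !inE fx'.
Qed.

(** If no part joins the two rows, the upper and lower sets vary independently, so every row equals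
    that of the empty set. *)
Lemma rk_neq1_propagating p :
  rk p != 1%N -> exists i j, inr j \in pblock p (inl i).
Proof.
move=> rk1; suff /existsP[i /existsP[j ij]] :
    [exists i, exists j, inr j \in pblock p (inl i)] by exists i, j.
apply: contraR rk1; rewrite negb_exists => /forallP no.
have np i j : (inr j \in pblock p (inl i)) = false.
  by have := no i; rewrite negb_exists => /forallP/(_ j)/negbTE.
have prod f f' x x' : saturated p f x -> saturated p f' x' -> saturated p f x'.
  move=> /saturatedP s1 /saturatedP s2; apply/saturatedP=> -[i|i] [j|j] ij.
  - by have := s1 _ _ ij; rewrite !inE.
  - by rewrite np in ij.
  - by move: ij; rewrite mem_pblock_same eq_sym -mem_pblock_same np.
  - by have := s2 _ _ ij; rewrite !inE.
rewrite eqn_leq rk_gt0 andbT -(cards1 (images p set0)).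
apply/subset_leq_card/subsetP=> _ /imsetP[f /domainP[x fx] ->].
apply/set1P/setP=> y; rewrite !inE; apply/idP/idP => sat.
  exact: prod (saturated0 p) sat.
exact: prod fx sat.
Qed.

(* The witness a is p with all the parts contained in the lower row merged into
   one propagating part. *)
Lemma lower_collapse p : rk p != 1%N -> exists a,
  [/\ forall f x, saturated a f x -> saturated p f x,
      forall f x, saturated p f x -> exists y, saturated a f y,
      upper_inj (flip a)
    & forall f f' x y, saturated p f x -> saturated p f' x ->
        saturated a f' y -> saturated a f y].
Proof.
case/rk_neq1_propagating=> i0 [j0 ij0].
pose up j := [exists i, inl i \in pblock p (inr j)].
pose lab (z : node n) := match z with
  | inl i => pblock p (inl i)
  | inr j => if up j then pblock p (inr j) else pblock p (inl i0) end.
have [/eqP cov _ _] := and3P (partsP p).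
have labr j : exists i, lab (inr j) = pblock p (inl i).
  rewrite /lab /up; case: ifP => [up_j|_]; last by exists i0.
  case/existsP: up_j => i.
  by rewrite mem_pblock_same => /eqP; exists i.
have labl i j : pblock p (inl i) = lab (inr j) ->
    exists k, inr k \in pblock p (inl i).
  rewrite /lab; case: ifP => _ ->; last by exists j0.
  by exists j; rewrite mem_pblock cov inE.
exists (label_diagram lab); split.
- move=> f x /saturated_labelP sat; apply/saturatedP=> u v uv; apply: sat.
  move: uv; rewrite mem_pblock_same => /eqP uv.
  have upE j i : pblock p (inr j) = pblock p (inl i) -> up j.
    by move=> E; apply/existsP; exists i; rewrite mem_pblock_same E.
  case: u v uv => [i|i] [j|j] //= uv.
  + by rewrite (upE j i).
  + by rewrite (upE i j).
  + suff -> : up i = up j by rewrite uv.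
    by apply: eq_existsb => k; rewrite uv.
- move=> f x /saturatedP sat.
  (* The lower set forced by f: all lower nodes that share a label with an upper node in f. *)
  exists [set j | [exists i, (i \in f) && (lab (inr j) == pblock p (inl i))]].
  have key i j : pblock p (inl i) = lab (inr j) ->
    (i \in f) = [exists k, (k \in f) && (lab (inr j) == pblock p (inl k))].
    move=> E; apply/idP/existsP=> [fi|[k /andP[fk]]].
      by exists i; rewrite fi E eqxx.
    rewrite -E => ik; have := sat (inl i) (inl k).
    by rewrite !inE mem_pblock_same => -> //; rewrite fk.
  apply/saturated_labelP=> -[i|i] [j|j] E; rewrite !inE.
  + by have := sat (inl i) (inl j); rewrite mem_pblock_same !inE; apply; apply/eqP.
  + exact: key.
  + by apply/esym/key.
  + by apply: eq_existsb => k; rewrite E.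
- apply/lower_injP=> f x y /saturated_labelP s1 /saturated_labelP s2.
  apply/setP=> j; have [i E] := labr j.
  have := s2 (inr j) (inl i) E; have := s1 (inr j) (inl i) E.
  by rewrite !inE => -> ->.
- move=> f f' x y /saturatedP s1 /saturatedP s2 /saturated_labelP s3.
  have key i j : pblock p (inl i) = lab (inr j) -> (i \in f) = (j \in y).
    move=> E; have [k ik] := labl _ _ E.
    have := s1 _ _ ik; have := s2 _ _ ik; have := s3 (inl i) (inr j) E.
    by rewrite !inE => -> -> ->.
  apply/saturated_labelP=> -[i|i] [j|j] E; rewrite !inE.
  + have := s1 (inl i) (inl j); rewrite mem_pblock_same !inE; apply.
    exact/eqP.
  + exact: key.
  + by apply/esym/key.
  + by have := s3 (inr i) (inr j) E; rewrite !inE.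
Qed.

Local Opaque compose loops flip rk domain.

Lemma saturated_composeP p q f x :
  reflect (exists2 y, saturated p f y & saturated q y x)
          (saturated (compose p q) f x).
Proof.
rewrite saturated_compose; apply: (iffP existsP) => [[y /andP[]]|[y fy yx]].
  by exists y.
by exists y; rewrite fy.
Qed.

Lemma diagram_ext p q :
  (forall f x, saturated p f x -> saturated q f x) ->
  (forall f x, saturated q f x -> saturated p f x) -> p = q.
Proof.
by move=> pq qp; apply: saturated_inj => f x; apply/idP/idP; [apply: pq|apply: qp].
Qed.

(* With a as in [lower_collapse], take b := a^* p. *)
Lemma factor_through_bij p : rk p != 1%N -> exists a b,
  [/\ compose a b = p, loops a b = 0%N, (rk (compose b a) <= rk p)%N,
      rk (compose b a) = rk p -> block_bij (compose b a)
        /\ domain (flip (compose b a)) = domain (compose b a)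
    & two_tonal p -> two_tonal a /\ two_tonal b].
Proof.
case/lower_collapse=> a [sub ext low shift]; pose b := compose (flip a) p.
have bP f x : saturated b f x -> exists2 y, saturated a y f & saturated p y x.
  by case/saturated_composeP=> y; rewrite saturated_flip; exists y.
have bI f x y : saturated a y f -> saturated p y x -> saturated b f x.
  by move=> yf yx; apply/saturated_composeP; exists y; rewrite ?saturated_flip.
have ab : compose a b = p.
  apply: diagram_ext => f x.
    case/saturated_composeP=> y fy /bP[f' /sub f'y f'x].
    exact: saturated_difunctional (sub _ _ fy) f'y f'x.
  move=> fx; have [y fy] := ext _ _ fx; apply/saturated_composeP.
  by exists y => //; apply: bI fx.
have inj_b : upper_inj b.
  apply/upper_injP=> f f' x /bP[u uf ux] /bP[v vf' vx].
  exact: (lower_injP a low) (shift _ _ _ _ vx ux uf) vf'.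
(* This identity serves to bound the rank of a by that of p. *)
have a_pb : a = compose p (flip b).
  apply: diagram_ext => f x.
    move=> fx; have fx' := sub _ _ fx; apply/saturated_composeP.
    by exists x => //; rewrite saturated_flip; apply: bI fx _.
  case/saturated_composeP=> y fy; rewrite saturated_flip => /bP[f' f'x f'y].
  exact: shift fy f'y f'x.
have rk_b : (rk b <= rk p)%N by apply: rk_composer.
have rk_a : (rk a <= rk p)%N by rewrite a_pb rk_composel.
have dom_ba : domain b = domain (flip a).
  apply/setP=> f; apply/domainP/domainP=> [[x /bP[y yf yx]]|[y]].
    by exists y; rewrite saturated_flip.
  by rewrite saturated_flip => yf; exists f; apply: bI yf (sub _ _ yf).
have card_b : #|domain b| = rk b by apply/esym/eqP.
have card_a : #|domain (flip a)| = rk a by rewrite -rk_flip; apply/esym/eqP.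
exists a, b; split.
- exact: ab.
- by rewrite loops_lower_inj.
- exact: leq_trans (rk_composel _ _) rk_b.
(* The domains of b and a^* have at most [rk p] elements, so equality of ranks turns both inclusions
   into equalities. *)
- move=> rkE; have d1 := domain_composel b a; have d2 := codomain_composer b a.
  have e1 : domain (compose b a) = domain b.
    apply/eqP; rewrite eqEcard d1 card_b /=; apply: leq_trans rk_b _.
    by rewrite -rkE rk_le_domain.
  have e2 : domain (flip (compose b a)) = domain (flip a).
    apply/eqP; rewrite eqEcard d2 card_a /=; apply: leq_trans rk_a _.
    by rewrite -rkE -rk_flip rk_le_domain.
  rewrite e2 e1 dom_ba /block_bij /upper_inj e1 e2 rk_flip dom_ba rkE card_a.
  have -> : rk a = rk p.
    by apply/eqP; rewrite eqn_leq rk_a /= -rkE rk_composer.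
  by rewrite eqxx.
- move=> /two_tonal_saturated tp; have ta : two_tonal a.
    by apply/two_tonal_saturated=> f x /sub/tp.
  split=> //; apply: two_tonal_compose; first exact: two_tonal_flip.
  exact/two_tonal_saturated.
Qed.

Lemma block_bij_compose p q :
  block_bij p -> block_bij q -> block_bij (compose p q).
Proof.
have inj r s : upper_inj r -> upper_inj s -> upper_inj (compose r s).
  move=> /upper_injP inj1 /upper_injP inj2; apply/upper_injP=> f f' x.
  move=> /saturated_composeP[y fy yx] /saturated_composeP[y' fy' yx'].
  by move: fy'; rewrite -(inj2 _ _ _ yx yx'); apply: inj1.
case/andP=> p1 p2 /andP[q1 q2]; apply/andP; split; first exact: inj.
by rewrite compose_flip inj.
Qed.

(** The composite q q^* is the identity relation on the domain of q, which is the codomain of g. *)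
Lemma compose_bijK g q : block_bij q -> domain (flip g) = domain q ->
  compose (compose g q) (flip q) = g.
Proof.
case/andP=> /upper_injP inj _ dom; apply: diagram_ext => f x.
  case/saturated_composeP=> y /saturated_composeP[z fz zy].
  by rewrite saturated_flip => /(inj _ _ _ zy) <-.
move=> fx; have : x \in domain q.
  by rewrite -dom; apply/domainP; exists f; rewrite saturated_flip.
case/domainP=> y xy; apply/saturated_composeP; exists y; rewrite ?saturated_flip //.
by apply/saturated_composeP; exists x.
Qed.

(** Reading block bijections as bijections from domain to codomain, this is the solution h = q^-1
    g^-1 q of g q h = q. *)
Definition conj_bij q g : diagram n := compose (compose (flip q) (flip g)) q.

Lemma saturated_conjP q g x y :
  reflect (exists f f', [/\ saturated q f' x, saturated g f f' & saturated q f y])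
          (saturated (conj_bij q g) x y).
Proof.
apply: (iffP (saturated_composeP _ _ _ _)) => [[f]|[f [f' [f'x ff' fy]]]].
  case/saturated_composeP=> f'; rewrite !saturated_flip => *.
  by exists f, f'.
exists f => //; apply/saturated_composeP; exists f'; by rewrite saturated_flip.
Qed.

(** The equation puts the domain of q inside that of g and the codomain of q inside that of h.
    Counting with the common rank makes these equalities, so q is a bijection and h can be solved
    for. *)
Lemma sandwich_fixed g q h :
  block_bij g -> block_bij h -> rk g = rk q -> rk h = rk q ->
  compose (compose g q) h = q ->
  [/\ block_bij q, domain q = domain g & h = conj_bij q g].
Proof.
move=> bg bh rg rh E.
have d1 : domain q \subset domain g.
  by rewrite -E; apply: subset_trans (domain_composel _ _) (domain_composel _ _).
have d2 : domain (flip q) \subset domain (flip h).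
  by rewrite -{1}E codomain_composer.
have cg : #|domain g| = rk q by rewrite card_domain_bij.
have ch : #|domain (flip h)| = rk q.
  by rewrite card_domain_bij ?block_bij_flip // rk_flip.
have e1 : domain q = domain g.
  by apply/eqP; rewrite eqEcard d1 cg rk_le_domain.
have e2 : domain (flip q) = domain (flip h).
  by apply/eqP; rewrite eqEcard d2 ch -rk_flip rk_le_domain.
have bq : block_bij q by rewrite /block_bij /upper_inj e1 e2 cg ch rk_flip eqxx.
split=> //; case/andP: bg => _ /lower_injP gi.
case/andP: bh => /upper_injP hi _; case/andP: bq => _ /lower_injP qi.
apply: diagram_ext => x y.
  move=> xy; have : y \in domain (flip q).
    by rewrite e2; apply/codomainP; exists x.
  case/codomainP=> f fy; have := fy; rewrite -{1}E.
  case/saturated_composeP=> x' /saturated_composeP[f' ff' f'x'] x'y.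
  by apply/saturated_conjP; exists f, f'; split=> //; rewrite (hi _ _ _ xy x'y).
case/saturated_conjP=> f [f' [f'x ff' fy]]; move: fy; rewrite -{1}E.
case/saturated_composeP=> x' /saturated_composeP[f1 ff1 f1x'].
by rewrite (gi _ _ _ ff1 ff') in f1x'; rewrite (qi _ _ _ f'x f1x').
Qed.

Lemma sandwich_conj g q :
  block_bij g -> block_bij q -> domain q = domain g ->
  domain (flip g) = domain g -> compose (compose g q) (conj_bij q g) = q.
Proof.
move=> /andP[/upper_injP gi _] /andP[/upper_injP qi _] d1 d2.
apply: diagram_ext => f y.
  case/saturated_composeP=> x /saturated_composeP[f1 ff1 f1x].
  case/saturated_conjP=> f3 [f2 [f2x f3f2]].
  by rewrite (qi _ _ _ f2x f1x) in f3f2; rewrite (gi _ _ _ f3f2 ff1).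
move=> fy; have : f \in domain g by rewrite -d1; apply/domainP; exists y.
case/domainP=> f1 ff1; have : f1 \in domain q.
  by rewrite d1 -d2; apply/codomainP; exists f.
case/domainP=> x f1x; apply/saturated_composeP; exists x.
  by apply/saturated_composeP; exists f1.
by apply/saturated_conjP; exists f, f1.
Qed.

Lemma conj_bijP g q :
  block_bij g -> block_bij q -> domain q = domain g ->
  domain (flip g) = domain g ->
  [/\ block_bij (conj_bij q g), rk (conj_bij q g) = rk q
    & domain (conj_bij q g) = domain (flip q)].
Proof.
move=> bg bq d1 d2; have bh : block_bij (conj_bij q g).
  by rewrite !block_bij_compose ?block_bij_flip.
have rh : rk (conj_bij q g) = rk q.
  apply/eqP; rewrite eqn_leq rk_composer /=.
  rewrite -{1}(sandwich_conj bg bq d1 d2); exact: rk_composer.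
split=> //; apply/eqP; rewrite eqEcard.
rewrite !card_domain_bij ?block_bij_flip // rk_flip rh leqnn andbT.
exact: subset_trans (domain_composel _ _) (domain_composel _ _).
Qed.

Lemma flip_conj q g : flip (conj_bij q g) = compose (flip q) (compose g q).
Proof. by rewrite compose_flip compose_flip !flipK. Qed.

Definition bijs (k : nat) : {set diagram n} :=
  [set q | [&& two_tonal q, block_bij q & rk q == k]].

Definition bijs_from (k : nat) (X : {set {set 'I_n}}) : {set diagram n} :=
  [set q in bijs k | domain q == X].

(** Composition with r^* on the left injects the bijections starting at the domain of r into those
    starting at its codomain; apply this to q and to q^*. *)
Lemma card_bijs_from k q : q \in bijs k ->
  #|bijs_from k (domain q)| = #|bijs_from k (domain (flip q))|.
Proof.
have half r : r \in bijs k ->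
    (#|bijs_from k (domain r)| <= #|bijs_from k (domain (flip r))|)%N.
  rewrite inE => /and3P[tr br /eqP rr].
  have rK s : domain s = domain r -> compose r (compose (flip r) s) = s.
    move=> ds; have := @compose_bijK (flip s) r br.
    by rewrite !flipK => /(_ ds)/(congr1 (@flip n)); rewrite !compose_flip !flipK.
  rewrite -(card_in_imset (f := compose (flip r))).
    apply/subset_leq_card/subsetP=> _ /imsetP[s + ->].
    rewrite !inE => /andP[/and3P[ts bs /eqP rs] /eqP ds].
    rewrite two_tonal_compose ?two_tonal_flip // block_bij_compose ?block_bij_flip //=.
    rewrite eqn_leq -{1}rs rk_composer -rs -{1}(rK s ds) rk_composer /=.
    rewrite eqEsubset domain_composel; apply/subsetP=> x /codomainP[f fx].
    have : f \in domain s by rewrite ds; apply/domainP; exists x.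
    case/domainP=> y fy; apply/domainP; exists y; apply/saturated_composeP.
    by exists f; rewrite ?saturated_flip.
  move=> s s'; rewrite !inE => /andP[_ /eqP ds] /andP[_ /eqP ds'] E.
  by rewrite -(rK s ds) E rK.
move=> kq; apply/eqP; rewrite eqn_leq half //= -{2}[q]flipK half //.
by move: kq; rewrite !inE block_bij_flip rk_flip => /and3P[/two_tonal_flip-> -> ->].
Qed.

End Factor.

(** * Trace functions *)

(** In a rank factorization M = C R, cancelling C on the left and R on the right in C R C R = 0
    leaves R C = 0, and R C has the trace of M. *)
Lemma mxtrace_sqr0 (K : fieldType) (m : nat) (M : 'M[K]_m) :
  M *m M = 0 -> \tr M = 0.
Proof.
rewrite -(mulmx_base M); set C := col_base M; set R := row_base M => M0.
rewrite mxtrace_mulC; suff -> : R *m C = 0 by rewrite mxtrace0.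
have Rfree : row_free R by apply: row_base_free.
have Cfull : row_full C by apply: col_base_full.
apply: (row_full_inj Cfull); rewrite mulmx0.
by apply: (row_free_inj Rfree); rewrite /= mul0mx -M0 !mulmxA.
Qed.

Lemma mxtrace_swap (K : fieldType) (m : nat) (P Q H : 'M[K]_m) :
  P *m H = H *m P -> \tr (P *m Q *m H) = \tr (Q *m P *m H).
Proof. by move=> PH; rewrite -[Q *m P *m H]mulmxA PH mulmxA [RHS]mxtrace_mulC mulmxA. Qed.

Section Layers.
Variables (K : fieldType) (n : nat) (delta : K).
Local Notation A := (partition_algebra n delta).
Local Notation e := (@diagram_vec K n delta).
Implicit Types (p q g h : diagram n) (x y z : A) (psi : diagram n -> K).
Local Opaque compose loops flip rk domain two_tonal.

Definition supported_even x := forall p, x p != 0 -> two_tonal p.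

Definition extend psi x : K := \sum_p x p * psi p.

(** This is psi(x y) = psi(y x) for the linear extension of psi, tested on the basis of the
    two-tonal algebra. *)
Definition trace_function psi := forall p q, two_tonal p -> two_tonal q ->
  delta ^+ loops p q * psi (compose p q) = delta ^+ loops q p * psi (compose q p).

Definition kills_sqr0 psi :=
  forall z, supported_even z -> z * z = 0 -> extend psi z = 0.

Lemma diagram_mul p q : e p * e q = delta ^+ loops p q *: e (compose p q).
Proof. exact: diagram_vec_mul. Qed.

Definition layer (k : nat) : {set diagram n} := [set p | two_tonal p & rk p == k].

(** For linear filtered F, the matrix of the operator induced on even diagrams of rank at most k
    modulo lower rank. *)
Definition layer_mx k (F : A -> A) : 'M[K]_#|layer k| :=
  \matrix_(i, j) F (e (enum_val j)) (enum_val i).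

Definition filtered (F : A -> A) := forall p q,
  two_tonal q -> F (e q) p != 0 -> two_tonal p && (rk p <= rk q)%N.

(** An intermediate diagram with nonzero contribution is even and has rank both at most and at least
    k, so it lies in the layer. *)
Lemma layer_mx_comp k (F G : A -> A) :
  (forall x p, F x p = \sum_q x q * F (e q) p) -> filtered F -> filtered G ->
  layer_mx k (fun x => F (G x)) = layer_mx k F *m layer_mx k G.
Proof.
move=> linF filtF filtG; apply/matrixP=> i j; rewrite !mxE linF.
have := enum_valP i; have := enum_valP j; rewrite !inE.
set p := enum_val i; set q := enum_val j => /andP[tq /eqP rq] /andP[tp /eqP rp].
rewrite (bigID (mem (layer k))) /= [X in _ + X]big1 ?addr0 => [|r].
  by rewrite big_enum_val; apply: eq_bigr => l _; rewrite !mxE mulrC.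
rewrite inE => nr; have [->|Gr] := eqVneq (G (e q) r) 0; first by rewrite mul0r.
have /andP[tr rr] := filtG _ _ tq Gr.
have [->|Fr] := eqVneq (F (e r) p) 0; first by rewrite mulr0.
have /andP[_ rpr] := filtF _ _ tr Fr.
by case/negP: nr; rewrite tr eqn_leq -{1}rq rr -rp rpr.
Qed.

Lemma mulr_expand x y p : (x * y) p = \sum_q y q * (x * e q) p.
Proof.
rewrite {1}[y]diagram_vec_sum mulr_sumr sum_ffunE; apply: eq_bigr => q _.
by rewrite -scalerAr partition_coefZ.
Qed.

Lemma mull_expand x y p : (y * x) p = \sum_q y q * (e q * x) p.
Proof.
rewrite {1}[y]diagram_vec_sum mulr_suml sum_ffunE; apply: eq_bigr => q _.
by rewrite -scalerAl partition_coefZ.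
Qed.

Lemma diagram_coef p q r : (e p * e q) r = delta ^+ loops p q * (r == compose p q)%:R.
Proof. by rewrite diagram_mul partition_coefZ ffunE. Qed.

Lemma filtered_mull x : supported_even x -> filtered (fun y => x * y).
Proof.
move=> even p q tq; rewrite mull_expand; apply: contraNT => np.
rewrite big1 // => r _; have [->|xr] := eqVneq (x r) 0; first by rewrite mul0r.
rewrite diagram_coef; case: eqP => [E|_]; last by rewrite !mulr0.
move: np; rewrite E rk_composer andbT => /negP[].
by apply: two_tonal_compose => //; apply: even.
Qed.

Lemma filtered_mulr x : supported_even x -> filtered (fun y => y * x).
Proof.
move=> even p q tq; rewrite mulr_expand; apply: contraNT => np.
rewrite big1 // => r _; have [->|xr] := eqVneq (x r) 0; first by rewrite mul0r.
rewrite diagram_coef; case: eqP => [E|_]; last by rewrite !mulr0.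
move: np; rewrite E rk_composel andbT => /negP[].
by apply: two_tonal_compose => //; apply: even.
Qed.

Lemma diagram_even p : two_tonal p -> supported_even (e p).
Proof.
by move=> tp q; rewrite ffunE; case: (eqVneq q p) => [->|]; rewrite ?eqxx.
Qed.

Local Opaque diagram_vec partition_mul.

Definition left_mx k x := layer_mx k (fun y => x * y).
Definition right_mx k x := layer_mx k (fun y => y * x).

Lemma left_mxM k x y : supported_even x -> supported_even y ->
  left_mx k (x * y) = left_mx k x *m left_mx k y.
Proof.
move=> ex ey; rewrite -layer_mx_comp; last exact: filtered_mull.
- by apply/matrixP=> i j; rewrite !mxE mulrA.
- by move=> z p; rewrite mulr_expand.
- exact: filtered_mull.
Qed.

Lemma left_right_mx k x y : supported_even x -> supported_even y ->
  left_mx k x *m right_mx k y = layer_mx k (fun z => x * (z * y)).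
Proof.
move=> ex ey; rewrite -layer_mx_comp //; last exact: filtered_mulr.
- by move=> z p; rewrite mulr_expand.
- exact: filtered_mull.
Qed.

Lemma left_right_mxC k x y : supported_even x -> supported_even y ->
  left_mx k x *m right_mx k y = right_mx k y *m left_mx k x.
Proof.
move=> ex ey; rewrite left_right_mx // -layer_mx_comp; last exact: filtered_mull.
- by apply/matrixP=> i j; rewrite !mxE mulrA.
- by move=> z p; rewrite mull_expand.
- exact: filtered_mulr.
Qed.

Lemma left_mx_expand k x : left_mx k x = \sum_p x p *: left_mx k (e p).
Proof.
apply/matrixP=> i j; rewrite summxE !mxE mull_expand.
by apply: eq_bigr => p _; rewrite !mxE.
Qed.

(* The trace of y |-> x y h on the layer, i.e. on the subquotient spanned by
   the diagrams of a given rank. *)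
Definition bimodule_trace k h p : K := \tr (left_mx k (e p) *m right_mx k (e h)).

Lemma extend_bimodule_trace k h x :
  extend (bimodule_trace k h) x = \tr (left_mx k x *m right_mx k (e h)).
Proof.
rewrite left_mx_expand mulmx_suml raddf_sum; apply: eq_bigr => p _ /=.
by rewrite -scalemxAl mxtraceZ.
Qed.

Lemma extend_diagram_mul psi p q :
  extend psi (e p * e q) = delta ^+ loops p q * psi (compose p q).
Proof.
rewrite /extend (bigD1 (compose p q)) //= diagram_coef eqxx mulr1 big1 ?addr0 //.
by move=> r /negbTE nr; rewrite diagram_coef nr mulr0 mul0r.
Qed.

Lemma bimodule_trace_function k h : two_tonal h ->
  trace_function (bimodule_trace k h).
Proof.
move=> th.
have E p q : two_tonal p -> two_tonal q ->
    delta ^+ loops p q * bimodule_trace k h (compose p q)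
    = \tr (left_mx k (e p) *m left_mx k (e q) *m right_mx k (e h)).
  move=> tp tq; rewrite -extend_diagram_mul extend_bimodule_trace.
  by rewrite left_mxM //; apply: diagram_even.
move=> p q tp tq; apply: etrans (E p q tp tq) (esym (etrans (E q p tq tp) _)).
apply/esym/mxtrace_swap.
exact: left_right_mxC (diagram_even tp) (diagram_even th).
Qed.

(** Left and right multiplications commute, so the operator y |-> z y h squares to zero on the layer
    along with z. *)
Lemma bimodule_trace_kills k h : two_tonal h -> kills_sqr0 (bimodule_trace k h).
Proof.
move=> th z ez zz; have eh := diagram_even th.
rewrite (extend_bimodule_trace k h z); apply: mxtrace_sqr0.
have := left_mxM k ez ez; rewrite zz; move: (left_right_mxC k ez eh).
move: (left_mx k z) (right_mx k (e h)) => L H LH LL.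
have -> : L *m H *m (L *m H) = L *m L *m (H *m H).
  by rewrite -!mulmxA (mulmxA H) -LH !mulmxA.
rewrite -LL.
suff -> : left_mx k 0 = 0 by rewrite mul0mx.
by apply/matrixP=> i j; rewrite !mxE mul0r ffunE.
Qed.

Lemma bimodule_trace_low k h p : two_tonal p -> (rk p < k)%N ->
  bimodule_trace k h p = 0.
Proof.
move=> tp rp; rewrite /bimodule_trace.
suff -> : left_mx k (e p) = 0 by rewrite mul0mx mxtrace0.
apply/matrixP=> i j; rewrite !mxE diagram_coef.
have := enum_valP i; rewrite inE => /andP[_ /eqP ri].
case: eqP => [E|_]; last by rewrite mulr0.
by have := rk_composel p (enum_val j); rewrite -E ri leqNgt rp.
Qed.

Lemma bimodule_trace_bij k g h : two_tonal g -> two_tonal h ->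
  block_bij g -> block_bij h ->
  bimodule_trace k h g = \sum_(q in layer k) (compose (compose g q) h == q)%:R.
Proof.
move=> tg th /andP[_ bg] /andP[bh _].
rewrite /bimodule_trace left_right_mx; try exact: diagram_even.
rewrite big_enum_val; apply: eq_bigr => i _; rewrite mxE mulrA.
by rewrite diagram_mul -scalerAl partition_coefZ diagram_coef eq_sym
  loops_lower_inj // loops_upper_inj // !mul1r.
Qed.

Lemma kills_sqr0_sum (I : finType) (P : pred I) (c : I -> K) (F : I -> diagram n -> K) :
  (forall i, P i -> kills_sqr0 (F i)) ->
  kills_sqr0 (fun p => \sum_(i | P i) c i * F i p).
Proof.
move=> kF z ez zz; rewrite /extend.
transitivity (\sum_(i | P i) c i * extend (F i) z); last first.
  by apply: big1 => i Pi; rewrite kF ?mulr0.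
transitivity (\sum_p \sum_(i | P i) c i * (z p * F i p)).
  by apply: eq_bigr => p _; rewrite mulr_sumr; apply: eq_bigr => i _; rewrite mulrCA.
by rewrite exchange_big; apply: eq_bigr => i _; rewrite -mulr_sumr.
Qed.

Lemma trace_function_sum (I : finType) (P : pred I) (c : I -> K) (F : I -> diagram n -> K) :
  (forall i, P i -> trace_function (F i)) ->
  trace_function (fun p => \sum_(i | P i) c i * F i p).
Proof.
move=> tF p q tp tq; rewrite [LHS]mulr_sumr [RHS]mulr_sumr.
by apply: eq_bigr => i Pi; rewrite [LHS]mulrCA [RHS]mulrCA; congr (_ * _); apply: tF.
Qed.

Local Opaque bimodule_trace.

Hypothesis char0 : forall m, m.+1%:R != 0 :> K.

(* Weighted so that it agrees with psi on the block bijections of rank k. *)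
Definition bij_trace k psi p : K := \sum_(h in bijs n k)
  psi (flip h) / #|bijs_from k (domain h)|%:R * bimodule_trace k h p.

Lemma bijsP k q : reflect [/\ two_tonal q, block_bij q & rk q = k] (q \in bijs n k).
Proof. by rewrite inE; apply: (iffP and3P) => -[? ? /eqP]. Qed.

Lemma bij_trace_bij k psi g : trace_function psi -> g \in bijs n k ->
  domain (flip g) = domain g -> bij_trace k psi g = psi g.
Proof.
move=> tpsi /bijsP[tg bg rg] dg.
have N0 : #|bijs_from k (domain g)|%:R != 0 :> K.
  have : (0 < #|bijs_from k (domain g)|)%N.
    apply/card_gt0P; exists g; rewrite inE eqxx andbT; exact/bijsP.
  by case: #|_|.
transitivity (\sum_(q in bijs_from k (domain g)) psi g / #|bijs_from k (domain g)|%:R);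
  last by rewrite sumr_const -[LHS]mulr_natr divfK.
transitivity (\sum_(q in layer k) \sum_(h in bijs n k | compose (compose g q) h == q)
    psi (flip h) / #|bijs_from k (domain h)|%:R).
  rewrite /bij_trace; under eq_bigr => h /bijsP[th bh _].
    rewrite bimodule_trace_bij // mulr_sumr; over.
  rewrite exchange_big; apply: eq_bigr => q _ /=; rewrite [RHS]big_mkcondr.
  by apply: eq_bigr => h _; case: eqP; rewrite ?mulr1 ?mulr0.
rewrite (bigID (mem (bijs_from k (domain g)))) /= [X in _ + X]big1 ?addr0; last first.
  move=> q /andP[]; rewrite inE => /andP[tq /eqP rq] nq; apply: big1 => h.
  case/andP=> /bijsP[th bh rh] /eqP E; case/negP: nq.
  have [|| bq dq _] := sandwich_fixed bg bh _ _ E; rewrite ?rq //.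
  by rewrite inE dq eqxx andbT; apply/bijsP.
apply: eq_big => [q|q].
  rewrite !inE; case: (two_tonal q); case: (rk q == k); by rewrite ?andbF ?andbT.
case/andP=> _ ; rewrite inE => /andP[/bijsP[tq bq rq] /eqP dq].
have [bh rh dh] := conj_bijP bg bq dq dg.
have th : two_tonal (conj_bij q g).
  by rewrite !two_tonal_compose ?two_tonal_flip.
rewrite (big_pred1 (conj_bij q g)) => [|h /=].
  rewrite dh -card_bijs_from ?dq; last exact/bijsP.
  congr (_ / _); rewrite flip_conj.
  have [bq1 bq2] := andP bq.
  have := tpsi (flip q) (compose g q) (two_tonal_flip tq) (two_tonal_compose tg tq).
  rewrite loops_lower_inj ?flipK // (loops_upper_inj _ bq2) !mul1r => ->.
  by rewrite compose_bijK // dg dq.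
apply/andP/eqP=> [[/bijsP[_ bh' rh'] /eqP E]|->].
  by have [|| _ _ ->] := sandwich_fixed bg bh' _ _ E; rewrite ?rq.
split; last by apply/eqP/sandwich_conj.
by apply/bijsP; rewrite rh.
Qed.

(** Writing p = a b, the trace property moves the question to b a. Either its rank drops, and both
    functions vanish, or it is a block bijection with equal domain and codomain. *)
Lemma bij_layer k psi : k != 1%N -> trace_function psi ->
  (forall p, two_tonal p -> (rk p < k)%N -> psi p = 0) ->
  [/\ trace_function (bij_trace k psi), kills_sqr0 (bij_trace k psi)
    & forall p, two_tonal p -> (rk p <= k)%N -> bij_trace k psi p = psi p].
Proof.
move=> k1 tpsi low.
have tT : trace_function (bij_trace k psi).
  by apply: trace_function_sum => h /bijsP[th _ _]; apply: bimodule_trace_function.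
have lowT p : two_tonal p -> (rk p < k)%N -> bij_trace k psi p = psi p.
  move=> tp rp; rewrite low //; apply: big1 => h _.
  by rewrite bimodule_trace_low ?mulr0.
split=> // [|p tp].
  by apply: kills_sqr0_sum => h /bijsP[th _ _]; apply: bimodule_trace_kills.
rewrite leq_eqVlt => /predU1P[rp|]; last exact: lowT.
have [|a [b [ab lab rba bij tab]]] := @factor_through_bij n p; first by rewrite rp.
have [ta tb] := tab tp; have tba := two_tonal_compose tb ta.
have step phi : trace_function phi -> phi p = delta ^+ loops b a * phi (compose b a).
  by move=> tphi; have := tphi a b ta tb; rewrite ab lab mul1r.
rewrite (step _ tT) (step _ tpsi); congr (_ * _).
move: rba; rewrite leq_eqVlt => /predU1P[rba|]; last by rewrite rp; apply: lowT.
have [bba dba] := bij rba; apply: bij_trace_bij => //.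
by apply/bijsP; rewrite rba rp.
Qed.

(** * The layer without propagating parts *)

Lemma rk1_sandwich p q : rk p = 1%N -> rk q = 1%N ->
  compose (compose p q) (compose q p) = p.
Proof.
move=> rp rq; apply: diagram_ext => f x.
  case/saturated_composeP=> y /saturated_composeP[y1 fy1 _].
  case/saturated_composeP=> y2 _ y2x; exact: rk1_product rp fy1 y2x.
move=> fx; apply/saturated_composeP; exists set0; apply/saturated_composeP;
  exists set0; rewrite ?saturated0 //.
- exact: rk1_product rp fx (saturated0 p).
- exact: rk1_product rp (saturated0 p) fx.
Qed.

Lemma rk1_idem p : rk p = 1%N -> compose p p = p.
Proof.
move=> rp; apply: diagram_ext => f x.
  case/saturated_composeP=> y fy yx; exact: rk1_product rp fy yx.
move=> fx; apply/saturated_composeP; exists set0.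
  exact: rk1_product rp fx (saturated0 p).
exact: rk1_product rp (saturated0 p) fx.
Qed.

(** The loops are counted by the sets in both the codomain of p and the domain of q, and p q = q
    makes the domains of p and q agree. *)
Lemma loops_rk1 p q : rk p = 1%N -> rk q = 1%N -> compose p q = q ->
  loops p q = loops p p.
Proof.
move=> rp rq E; have half r : rk r = 1%N -> compose p r = r ->
    (2 ^ loops p r)%N = #|[set g | (g \in domain (flip p)) && (g \in domain p)]|.
  move=> rr Er; have := count_middle p r set0 set0.
  rewrite saturated0 muln1 => <-; congr #|pred_of_set _|; apply/setP=> g; rewrite in_set [RHS]in_set.
  congr andb.
    apply/idP/codomainP=> [sat|[f fg]]; first by exists set0.
    exact: rk1_product rp (saturated0 p) fg.
  apply/idP/domainP=> [|[x gx]].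
    rewrite -{1}Er => /saturated_composeP[y gy _]; by exists y.
  rewrite -Er; apply/saturated_composeP; exists set0; last exact: saturated0.
  exact: rk1_product rp gx (saturated0 p).
have pp := rk1_idem rp.
by apply: (@expnI 2 isT); rewrite (half q) ?(half p).
Qed.

Definition layer1_trace p : K := \tr (left_mx 1 (e p)).

Lemma extend_layer1_trace x : extend layer1_trace x = \tr (left_mx 1 x).
Proof.
rewrite left_mx_expand raddf_sum; apply: eq_bigr => p _ /=.
by rewrite mxtraceZ.
Qed.

Lemma layer1_trace_function : trace_function layer1_trace.
Proof.
have E p q : two_tonal p -> two_tonal q ->
    delta ^+ loops p q * layer1_trace (compose p q)
    = \tr (left_mx 1 (e p) *m left_mx 1 (e q)).
  move=> tp tq; rewrite -extend_diagram_mul extend_layer1_trace.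
  by rewrite left_mxM //; apply: diagram_even.
move=> p q tp tq; apply: etrans (E p q tp tq) (esym (etrans (E q p tq tp) _)).
exact: mxtrace_mulC.
Qed.

Lemma layer1_trace_kills : kills_sqr0 layer1_trace.
Proof.
move=> z ez zz; rewrite (extend_layer1_trace z); apply: mxtrace_sqr0.
rewrite -left_mxM // zz; apply/matrixP=> i j.
by rewrite !mxE mul0r ffunE.
Qed.

(** Every diagram fixed by p contributes the same power of delta, and p fixes itself, so in
    characteristic zero nothing cancels. *)
Lemma layer1_trace_neq0 p : delta != 0 -> two_tonal p -> rk p = 1%N ->
  layer1_trace p != 0.
Proof.
move=> d0 tp rp.
have -> : layer1_trace p = \sum_(q in layer 1) (q == compose p q)%:R * delta ^+ loops p p.
  rewrite big_enum_val; apply: eq_bigr => i _; rewrite mxE diagram_coef.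
  have := enum_valP i; rewrite inE => /andP[_ /eqP ri].
  case: eqP => [Ei|_]; last by rewrite mulr0 mul0r.
  by rewrite (loops_rk1 rp ri) // mulrC.
rewrite -mulr_suml mulf_neq0 ?expf_neq0 // -natr_sum.
rewrite (bigD1 p) /=; last by rewrite inE tp rp eqxx.
by rewrite rk1_idem // eqxx add1n char0.
Qed.

(** Since (p p0)(p0 p) = p and (p0 p)(p p0) = p0 up to powers of delta, a trace function on this
    layer is determined by its value at one diagram p0; a multiple of [layer1_trace] matches it. *)
Lemma layer1 psi : delta != 0 \/ (forall p, two_tonal p -> rk p != 1%N) ->
  trace_function psi -> exists2 phi, trace_function phi /\ kills_sqr0 phi
    & forall p, two_tonal p -> (rk p <= 1)%N -> phi p = psi p.
Proof.
move=> d0 tpsi.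
case: (boolP [exists p : diagram n, two_tonal p && (rk p == 1%N)]) => [|no]; last first.
  exists (fun=> 0 : K).
    split=> [p q _ _|z _ _]; first by rewrite [LHS]mulr0 [RHS]mulr0.
    by apply: big1 => p _; rewrite mulr0.
  move=> p tp rp; case/negP: no; apply/existsP; exists p.
  by rewrite tp eqn_leq rp rk_gt0.
case/existsP=> p0 /andP[t0 /eqP r0]; have {}d0 : delta != 0.
  by case: d0 => // /(_ p0 t0); rewrite r0.
have T0 := layer1_trace_neq0 d0 t0 r0.
pose c := psi p0 / layer1_trace p0.
have trS phi a : trace_function phi -> trace_function (fun p => a * phi p).
  move=> tphi p q tp tq; rewrite [LHS]mulrCA [RHS]mulrCA; congr (_ * _).
  exact: tphi.
exists (fun p => c * layer1_trace p).
  split=> [|z ez zz]; first exact/trS/layer1_trace_function.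
  transitivity (c * extend layer1_trace z).
    by rewrite mulr_sumr; apply: eq_bigr => p _; rewrite mulrCA.
  by rewrite layer1_trace_kills ?mulr0.
move=> p tp rp; have {}rp : rk p = 1%N by apply/eqP; rewrite eqn_leq rp rk_gt0.
have step phi : trace_function phi ->
    delta ^+ loops (compose p p0) (compose p0 p) * phi p
    = delta ^+ loops (compose p0 p) (compose p p0) * phi p0.
  move=> tphi.
  have := tphi (compose p p0) (compose p0 p) (two_tonal_compose tp t0)
             (two_tonal_compose t0 tp).
  by rewrite !rk1_sandwich.
apply: (mulfI (expf_neq0 (loops (compose p p0) (compose p0 p)) d0)).
have tphi := trS _ c layer1_trace_function.
apply: etrans (step _ tphi) (esym (etrans (step _ tpsi) _)).
by congr (_ * _); rewrite /c divfK.
Qed.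

(* Downward induction on k for trace functions vanishing on rank < k: subtract
   a trace function that agrees on rank k and is known to kill z. *)
Lemma trace_kills_sqr0 psi :
  delta != 0 \/ (forall p, two_tonal p -> rk p != 1%N) ->
  trace_function psi -> kills_sqr0 psi.
Proof.
(* B exceeds every rank, so the induction ends with a function vanishing on all even diagrams. *)
move=> d0; pose B := #|{: {set 'I_n}}|.+1.
have rkB p : (rk p < B)%N by rewrite ltnS (leq_trans (rk_le_domain p)) ?max_card.
suff main m : forall k phi, (B <= k + m)%N -> trace_function phi ->
    (forall p, two_tonal p -> (rk p < k)%N -> phi p = 0) -> kills_sqr0 phi.
  by move=> tpsi; apply: (main B 0%N).
elim: m => [|m IHm] k phi Bk tphi low.
  move=> z ez _; apply: big1 => p _; have [->|zp] := eqVneq (z p) 0.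
    by rewrite mul0r.
  rewrite low ?mulr0 //; first exact: ez.
  by rewrite (leq_trans (rkB p)) // -(addn0 k).
have [theta [tT kT] eqT] : exists2 theta, trace_function theta /\ kills_sqr0 theta
    & forall p, two_tonal p -> (rk p <= k)%N -> theta p = phi p.
  have [->|k1] := eqVneq k 1%N; first exact: layer1.
  have [tT kT eqT] := bij_layer k1 tphi low.
  by exists (bij_trace k phi).
have tD : trace_function (fun p => phi p - theta p).
  move=> p q tp tq; rewrite [LHS]mulrBr [RHS]mulrBr; congr (_ - _).
    exact: tphi.
  exact: tT.
have kD : kills_sqr0 (fun p => phi p - theta p).
  apply: (IHm k.+1) => // [|p tp rp]; first by rewrite addSnnS.
  by rewrite eqT ?subrr.
move=> z ez zz; have := kD z ez zz; have := kT z ez zz.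
rewrite /extend => T0; under eq_bigr do rewrite mulrBr.
by rewrite sumrB T0 subr0.
Qed.

End Layers.

(** * Counting colorings of joins *)

Section Colorings.
Variables X T : finType.

(** Such a colouring is determined by arbitrary values at the chosen roots of the components. *)
Lemma card_constant_colorings (e : rel X) : connect_sym e ->
  #|[set F : {ffun X -> T} | [forall x, forall y, e x y ==> (F x == F y)]]|
  = (#|T| ^ #|roots e|)%N.
Proof.
move=> sym; rewrite -(card_sig (roots e)) -card_ffun.
have root_in x : roots e (fingraph.root e x) by apply: roots_root.
pose F (G : {ffun {x | roots e x} -> T}) := [ffun x => G (Sub _ (root_in x))].
have injF : injective F.
  move=> G G' /ffunP eqF; apply/ffunP=> -[x rx].
  have := eqF x; rewrite !ffunE; have E : fingraph.root e x = x by apply/eqP.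
  by congr (_ = _); congr (fun_of_fin _ _); apply: val_inj.
rewrite -(card_imset _ injF); congr #|pred_of_set _|; apply/setP=> H.
rewrite inE; apply/forallP/imsetP=> [cst|[G _ ->] x].
  exists [ffun x => H (val x)] => //; apply/ffunP=> x; rewrite !ffunE /=.
  have cl a : closed e [pred z | H z == a].
    apply: intro_closed => // u v uv; rewrite !inE => /eqP <-.
    by have /forallP/(_ v)/implyP/(_ uv) := cst u; rewrite eq_sym.
  have := closed_connect (cl (H x)) (connect_root e x).
  by rewrite !inE eqxx => /esym/eqP.
apply/forallP=> y; apply/implyP=> xy; rewrite !ffunE.
apply/eqP; congr (fun_of_fin _ _); apply: val_inj => /=.
by apply/(fingraph.rootP sym)/connect1.
Qed.

End Colorings.

Section Joins.
Variable n : nat.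
Implicit Types (p q k : diagram n).
Local Opaque compose loops.

Definition compatible (T : finType) p (F : {ffun node n -> T}) : bool :=
  [forall x, forall y, (y \in pblock p x) ==> (F x == F y)].

Lemma compatibleP (T : finType) p (F : {ffun node n -> T}) :
  reflect (forall x y, y \in pblock p x -> F x = F y) (compatible p F).
Proof.
apply: (iffP forallP) => [H x y xy|H x].
  by have /forallP/(_ y)/implyP/(_ xy)/eqP := H x.
by apply/forallP=> y; apply/implyP=> /H ->.
Qed.

Definition join_rel p q : rel (node n) :=
  fun x y => (y \in pblock p x) || (y \in pblock q x).

Definition join_parts p q : nat := #|roots (join_rel p q)|.

Lemma card_compatible (T : finType) p q :
  #|[set F : {ffun node n -> T} | compatible p F && compatible q F]|
  = (#|T| ^ join_parts p q)%N.
Proof.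
rewrite -card_constant_colorings; last first.
  apply: sym_connect_sym => x y; rewrite /join_rel !mem_pblock_same.
  by rewrite eq_sym [X in _ || X]eq_sym.
congr #|pred_of_set _|; apply/setP=> F; rewrite !inE.
apply/andP/forallP=> [[/compatibleP cp /compatibleP cq] x|H].
  by apply/forallP=> y; apply/implyP=> /orP[/cp|/cq] ->.
by split; apply/compatibleP=> x y xy; have /forallP/(_ y)/implyP := H x;
  rewrite /join_rel xy ?orbT => /(_ isT)/eqP.
Qed.

Definition kernel (T : finType) (F : {ffun node n -> T}) : diagram n := label_diagram F.

Definition coarser k p : bool := [forall x, pblock p x \subset pblock k x].

Lemma coarserP k p :
  reflect (forall x y, y \in pblock p x -> y \in pblock k x) (coarser k p).
Proof.
apply: (iffP forallP) => [H x y|H x]; first by apply/subsetP.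
by apply/subsetP=> y; apply: H.
Qed.

Lemma diagram_pblock_ext p q : (forall x, pblock p x = pblock q x) -> p = q.
Proof.
move=> E; apply: saturated_inj => f g.
by apply/saturatedP/saturatedP=> H x y xy; apply: H; rewrite ?E // -E.
Qed.

Lemma compatible_kernel (T : finType) p (F : {ffun node n -> T}) :
  compatible p F = coarser (kernel F) p.
Proof.
by apply/compatibleP/coarserP=> H x y /H; rewrite pblock_label => /eqP.
Qed.

(** A colouring with kernel k is an injective colouring of the parts of k. *)
Lemma card_kernel (T : finType) k :
  #|[set F : {ffun node n -> T} | kernel F == k]| = (#|T| ^_ #|parts k|)%N.
Proof.
have [/eqP cov triv n0] := and3P (partsP k).
have kP x : pblock k x \in parts k by rewrite pblock_mem ?cov ?inE.
have -> : #|parts k| = #|{: {B | B \in parts k}}| by rewrite card_sig.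
rewrite -card_inj_ffuns.
pose F (G : {ffun {B | B \in parts k} -> T}) := [ffun x => G (exist (fun B => B \in parts k) _ (kP x))].
have injF : injective F.
  move=> G G' /ffunP eqF; apply/ffunP=> -[B kB].
  have [B0|[x Bx]] := set_0Vmem B; first by move: n0; rewrite -B0 kB.
  have := eqF x; rewrite !ffunE; have E := def_pblock triv kB Bx.
  by congr (_ = _); congr (fun_of_fin _ _); apply: val_inj.
rewrite -(card_imset _ injF); congr #|pred_of_set _|; apply/setP=> H.
rewrite inE; apply/eqP/imsetP=> [HK|[G]].
  have HE x y : (H x == H y) = (y \in pblock k x) by rewrite -HK pblock_label.
  have rep (B : {B | B \in parts k}) : exists x, x \in val B.
    case: B => B /= kB; have [B0|[x Bx]] := set_0Vmem B; last by exists x.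
    by move: n0; rewrite -B0 kB.
  pose r B := xchoose (rep B); have rP B : r B \in val B by apply: xchooseP.
  have rK B : pblock k (r B) = val B by apply: def_pblock triv (valP B) (rP B).
  exists [ffun B => H (r B)].
    rewrite inE; apply/injectiveP=> B B'; rewrite !ffunE => /eqP.
    rewrite HE mem_pblock_same !rK => /eqP; exact: val_inj.
  apply/ffunP=> x; rewrite !ffunE; apply/eqP.
  by rewrite HE mem_pblock_same rK.
rewrite inE => /injectiveP injG ->; apply: diagram_pblock_ext => x.
apply/setP=> y; rewrite pblock_label !ffunE mem_pblock_same.
by rewrite (inj_eq injG).
Qed.

Lemma colorings_by_kernel (m : nat) p q :
  (m ^ join_parts p q = \sum_(k | coarser k p && coarser k q) m ^_ #|parts k|)%N.
Proof.
rewrite -[m in LHS]card_ord -card_compatible -sum1_card.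
rewrite (partition_big (@kernel 'I_m) (fun k => coarser k p && coarser k q)) /=.
  apply: eq_bigr => k /andP[kp kq].
  rewrite -[m in RHS]card_ord -card_kernel -sum1_card; apply: eq_bigl => F.
  rewrite !inE !compatible_kernel; case: eqP => [->|_]; rewrite ?andbF //.
  by rewrite kp kq.
by move=> F; rewrite inE !compatible_kernel.
Qed.

(** Pairs (f, g) saturated for both diagrams are the colourings of the join with two colours. *)
Lemma join_parts_saturated p q :
  (2 ^ join_parts p q = \sum_f \sum_g saturated p f g * saturated q f g)%N.
Proof.
rewrite pair_big /= -card_bool -card_compatible -sum1_card.
pose F (u : {set 'I_n} * {set 'I_n}) := [ffun x => x \in row_union u.1 u.2].
pose G (H : {ffun node n -> bool}) := ([set i | H (inl i)], [set i | H (inr i)]).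
have FK : cancel F G by case=> f g; congr pair; apply/setP=> i; rewrite !inE ffunE inE.
have GK : cancel G F by move=> H; apply/ffunP=> -[i|i]; rewrite !ffunE !inE.
rewrite (reindex F) /=; last by exists G => ? _.
rewrite big_mkcond /=; apply: eq_bigr => -[f g] _; rewrite inE /=.
have E r : compatible r (F (f, g)) = saturated r f g.
  by apply/compatibleP/saturatedP=> H x y /H; rewrite !ffunE.
by rewrite !E; case: saturated; case: saturated.
Qed.

(** With M_p the 0/1 matrix of [saturated p], two to either side is the trace of M_p M_q, where M_p
    M_q is 2 ^ [loops p q] times the matrix of the composite. *)
Lemma join_parts_flip p q :
  join_parts p (flip q) = (loops p q + join_parts (compose p q) (id_diagram n))%N.
Proof.
apply: (@expnI 2 isT); rewrite expnD !join_parts_saturated big_distrr /=.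
apply: eq_bigr => f _; rewrite [in RHS](bigD1 f) //= saturated_id eqxx muln1.
rewrite [X in (_ * (_ + X))%N]big1 ?addn0 => [|g]; last first.
  by rewrite saturated_id eq_sym => /negbTE->; rewrite muln0.
by rewrite -sum_saturated; apply: eq_bigr => g _; rewrite saturated_flip.
Qed.

Lemma join_partsC p q : join_parts p (flip q) = join_parts q (flip p).
Proof.
have E r s : (2 ^ join_parts r (flip s)
    = \sum_f \sum_g saturated r f g * saturated s g f)%N.
  rewrite join_parts_saturated; apply: eq_bigr => f _; apply: eq_bigr => g _.
  by rewrite saturated_flip.
apply: (@expnI 2 isT).
apply: etrans (E p q) (esym (etrans (E q p) _)); rewrite exchange_big /=.
by apply: eq_bigr => f _; apply: eq_bigr => g _; rewrite mulnC.
Qed.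

Hypothesis n_gt0 : (0 < n)%N.

Lemma join_parts_gt0 p q : (0 < join_parts p q)%N.
Proof.
pose x0 : node n := inl (Ordinal n_gt0).
apply/card_gt0P; exists (fingraph.root (join_rel p q) x0); apply: roots_root.
by apply: sym_connect_sym => x y; rewrite /join_rel !mem_pblock_same eq_sym [X in _ || X]eq_sym.
Qed.

Lemma card_parts_gt0 p : (0 < #|parts p|)%N.
Proof.
have [/eqP cov _ _] := and3P (partsP p).
apply/card_gt0P; exists (pblock p (inl (Ordinal n_gt0))).
by rewrite pblock_mem ?cov ?inE.
Qed.

End Joins.

(** * Nondegeneracy of the closure trace *)

Section Gram.
Variable K : fieldType.
Hypothesis char0 : forall m, m.+1%:R != 0 :> K.

Lemma natr_inj0 : injective (fun m : nat => m%:R : K).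
Proof.
suff half a b : (a <= b)%N -> a%:R = b%:R :> K -> a = b.
  move=> a b E; case: (leqP a b) => [/half|/ltnW/half H]; first exact.
  by apply/esym/H.
move=> ab E; apply/eqP; rewrite eqn_leq ab -subn_eq0.
have : (b - a)%:R = 0 :> K by rewrite natrB // E subrr.
by case: (b - a)%N => // m /eqP; rewrite (negbTE (char0 m)).
Qed.

Lemma poly_eq_nat (P Q : {poly K}) :
  (forall m : nat, P.[m%:R] = Q.[m%:R]) -> P = Q.
Proof.
move=> E; apply/eqP; rewrite -subr_eq0; apply/negPn/negP=> D0.
pose rs : seq K := [seq m%:R | m <- iota 0 (size (P - Q)) ].
have := max_poly_roots D0 (rs := rs); rewrite size_map size_iota ltnn.
case/(_ _ _)/Wrap => //; last by rewrite (map_inj_uniq natr_inj0) iota_uniq.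
by apply/allP=> _ /mapP[m _ ->]; rewrite /root !hornerE E subrr.
Qed.

Lemma natr_ffact (m j : nat) : (m ^_ j)%:R = \prod_(i < j) (m%:R - i%:R) :> K.
Proof.
elim: j => [|j IHj]; first by rewrite ffactn0 big_ord0.
rewrite big_ord_recr /= -IHj ffactnSr natrM.
have [jm|mj] := leqP j m; first by rewrite natrB.
by rewrite ffact_small // !mul0r.
Qed.

Variables (n : nat) (delta : K).
Hypothesis n_gt0 : (0 < n)%N.
Implicit Types (p q k : diagram n) (x : diagram n -> K).
Local Opaque compose loops join_parts two_tonal.

(* The falling factorial (delta)_j divided by delta, for 0 < j. *)
Definition reduced_ffact (j : nat) : K := \prod_(i < j.-1) (delta - i.+1%:R).

(* Both sides times delta are polynomial in delta, and at delta = m they count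
   the colorings of the join with m colors, sorted by their kernel. *)
Lemma gram_coarser p q : delta ^+ (join_parts p q).-1
  = \sum_(k | coarser k p && coarser k q) reduced_ffact #|parts k|.
Proof.
pose c (j : nat) : {poly K} := \prod_(i < j) ('X - i%:R%:P).
pose d (j : nat) : {poly K} := \prod_(i < j.-1) ('X - i.+1%:R%:P).
have cd j : (0 < j)%N -> c j = 'X * d j.
  by case: j => // j _; rewrite /c /d big_ord_recl /= subr0.
suff E : 'X ^+ (join_parts p q).-1 = \sum_(k | coarser k p && coarser k q) d #|parts k|.
  have := congr1 (horner^~ delta) E; rewrite hornerXn horner_sum => ->.
  apply: eq_bigr => k _; rewrite horner_prod; apply: eq_bigr => i _.
  by rewrite !hornerE.
have X0 : 'X != 0 :> {poly K} by rewrite polyX_eq0.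
apply: (mulfI X0); rewrite -exprS prednK ?join_parts_gt0 //.
rewrite mulr_sumr; under eq_bigr => k _ do rewrite -cd ?card_parts_gt0 //.
apply: poly_eq_nat => m; rewrite hornerXn horner_sum -natrX colorings_by_kernel natr_sum.
apply: eq_bigr => k _; rewrite natr_ffact horner_prod; apply: eq_bigr => i _.
by rewrite !hornerE.
Qed.

(** A strictly monotone measure for coarsening, used to run inductions along the refinement
    order. *)
Definition weight k : nat := #|[set u : node n * node n | u.2 \in pblock k u.1]|.

Lemma coarser_weight k p : coarser k p -> k != p -> (weight p < weight k)%N.
Proof.
move/coarserP=> kp neq; apply: proper_card; rewrite properEneq; apply/andP; split.
  apply: contra neq => /eqP/setP E; apply/eqP/diagram_pblock_ext=> x.
  by apply/setP=> y; have := E (x, y); rewrite !inE.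
by apply/subsetP=> -[x y]; rewrite !inE; apply: kp.
Qed.

Lemma coarser_refl k : coarser k k.
Proof. exact/coarserP. Qed.

Lemma two_tonal_coarser k p : coarser k p -> two_tonal p -> two_tonal k.
Proof.
move=> /coarserP kp /two_tonal_saturated tp; apply/two_tonal_saturated=> f g.
by move=> /saturatedP sat; apply/tp/saturatedP=> x y /kp; apply: sat.
Qed.

(** The factorization Z^T C Z is inverted in stages: [S] = Z x vanishes by induction from the
    coarsest diagrams, then x by induction from the finest. Coarsening preserves evenness, so both
    stay among even diagrams. *)
Lemma gram_nondegenerate x : (forall i, delta != i.+1%:R) ->
  (forall p, ~~ two_tonal p -> x p = 0) ->
  (forall p, two_tonal p -> \sum_q x q * delta ^+ (join_parts p q).-1 = 0) ->
  forall p, x p = 0.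
Proof.
move=> d_ok x0 orth.
pose S k := \sum_(q | coarser k q) x q.
have c0 j : reduced_ffact j != 0.
  by apply/prodf_neq0=> i _; rewrite subr_eq0.
have orthS p : two_tonal p -> \sum_(k | coarser k p) reduced_ffact #|parts k| * S k = 0.
  move=> tp; rewrite -[RHS](orth p tp) /S.
  transitivity (\sum_q \sum_(k | coarser k p && coarser k q)
                  x q * reduced_ffact #|parts k|).
    under eq_bigr => k _ do rewrite mulr_sumr.
    rewrite (exchange_big_dep xpredT) //=; apply: eq_bigr => q _.
    by apply: eq_bigr => k _; rewrite mulrC.
  by apply: eq_bigr => q _; rewrite gram_coarser mulr_sumr.
have S0 p : two_tonal p -> S p = 0.
  pose M := #|{: node n * node n}|; move: p.
  suff H m : forall p, (M - weight p < m)%N -> two_tonal p -> S p = 0.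
    by move=> p; apply: (H (M - weight p).+1).
  elim: m => // m IHm p pm tp; have := orthS p tp.
  rewrite (bigD1 p) ?coarser_refl //= big1 ?addr0 => [|k /andP[kp neq]].
    by move/eqP; rewrite mulf_eq0 (negbTE (c0 _)) => /eqP.
  rewrite IHm ?mulr0 //; last exact: two_tonal_coarser kp tp.
  have lt := coarser_weight kp neq; rewrite -ltnS; apply: leq_trans pm.
  by rewrite ltnS ltn_sub2l // (leq_trans lt) ?max_card.
move=> p; move: {2}(weight p).+1 (ltnSn (weight p)) => m.
elim: m p => // m IHm p pm; case: (boolP (two_tonal p)) => [tp|/x0 //].
have := S0 p tp; rewrite /S (bigD1 p) ?coarser_refl //= big1 ?addr0 // => q /andP[pq neq].
by apply: IHm; rewrite -ltnS (leq_trans _ pm) // ltnS coarser_weight // eq_sym.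
Qed.

(* The exponent is one less than the number of components of the closure:
   dividing the usual trace by delta keeps it nondegenerate at delta = 0. *)
Definition closure_trace p : K := delta ^+ (join_parts p (id_diagram n)).-1.

Lemma loops_closure_trace p q :
  delta ^+ loops p q * closure_trace (compose p q) = delta ^+ (join_parts p (flip q)).-1.
Proof.
rewrite join_parts_flip -exprD; congr (_ ^+ _).
by rewrite -[in RHS](prednK (join_parts_gt0 n_gt0 (compose p q) (id_diagram n))) addnS.
Qed.

Lemma closure_trace_function : trace_function delta closure_trace.
Proof. by move=> p q _ _; rewrite !loops_closure_trace join_partsC. Qed.

Lemma closure_trace_nondegenerate (y : partition_algebra n delta) :
  (forall i, delta != i.+1%:R) -> supported_even y ->
  (forall p, two_tonal p -> extend closure_trace (diagram_vec delta p * y) = 0) ->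
  y = 0.
Proof.
move=> d_ok ey orth; apply/ffunP=> q; rewrite [RHS]ffunE -[q]flipK.
(* The trace form pairs p with q through the join of p and q^*, so the coefficients are reindexed by
   reflection. *)
pose x q := y (flip q) : K; rewrite -/(x (flip q)).
apply: gram_nondegenerate => // {q} [p|p tp].
  by apply: contraNeq => /ey; apply: contraLR; apply: contra; rewrite -{2}[p]flipK; apply: two_tonal_flip.
rewrite -[RHS](orth p tp).
transitivity (\sum_q y q * (delta ^+ (join_parts p (flip q)).-1)).
  rewrite (reindex_inj (can_inj (@flipK n))); apply: eq_bigr => q _.
  by rewrite /x flipK.
rewrite [in RHS](diagram_vec_sum y) mulr_sumr.
transitivity (\sum_q y q * extend closure_trace (diagram_vec delta p * diagram_vec delta q)).
  by apply: eq_bigr => q _; rewrite extend_diagram_mul loops_closure_trace.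
rewrite /extend; under eq_bigr do rewrite mulr_sumr; rewrite exchange_big /=.
apply: eq_bigr => r _; rewrite sum_ffunE mulr_suml; apply: eq_bigr => q _.
by rewrite mulrA -scalerAr partition_coefZ.
Qed.

End Gram.

(** * A semisimplicity criterion *)

Section Semisimple.
Variables (K : fieldType) (B : falgType K).
Implicit Types (U V W S : {vspace B}) (a s x y e : B).

Lemma left_ideal_amulr U a : left_ideal U -> left_ideal (amulr a @: U)%VS.
Proof.
move=> lU y _ /memv_imgP[u Uu ->]; rewrite lfunE /= mulrA.
by apply/memv_imgP; exists (y * u); rewrite ?lU // lfunE.
Qed.

Lemma left_ideal_annihilator U a : left_ideal U ->
  left_ideal (U :&: lker (amulr a))%VS.
Proof.
move=> lU y u; rewrite !memv_cap !memv_ker !lfunE /= => /andP[Uu /eqP ua].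
by rewrite lU // -mulrA ua mulr0 eqxx.
Qed.

(** For s in a simple summand, the left ideal generated by x s is zero or contains s. In the latter
    case s = y x s, so x s = x y x s = 0. Hence x kills all summands, and so 1. *)
Lemma semisimple_sandwich0 x : semisimple B -> (forall y, x * y * x = 0) -> x = 0.
Proof.
case=> k [S [simS _ sumS]] xyx.
have xS i s : s \in S i -> x * s = 0.
  move=> Ss; have [lS _ minS] := simS i; pose W := (amulr (x * s) @: fullv)%VS.
  have WP y : y * (x * s) \in W by apply/memv_imgP; exists y; rewrite ?memvf ?lfunE.
  have lW : left_ideal W by apply: left_ideal_amulr => a u _; apply: memvf.
  have WS : (W <= S i)%VS.
    by apply/subvP=> _ /memv_imgP[y _ ->]; rewrite lfunE /= mulrA lS.
  case: (minS W lW WS) => E.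
    by have := WP 1; rewrite E memv0 mul1r => /eqP.
  move: Ss; rewrite -E => /memv_imgP[y _ ->].
  by rewrite lfunE /= !mulrA xyx mul0r.
have : 1 \in (\sum_i S i)%VS by rewrite sumS memvf.
case/memv_sumP=> v vS; rewrite -[x]mulr1 => ->; rewrite mulr_sumr big1 // => i _.
exact: xS (vS i isT).
Qed.

Lemma exists_simple_left_ideal U : left_ideal U -> U <> 0%VS ->
  exists2 S, simple_left_ideal S & (S <= U)%VS.
Proof.
move: {2}(\dim U).+1 (ltnSn (\dim U)) => m; elim: m U => // m IHm U dU lU U0.
have [[W [lW W0 WU neq]]|no] :=
    boolp.EM (exists W, [/\ left_ideal W, W <> 0%VS, (W <= U)%VS & W <> U]).
  have dW : (\dim W < m)%N.
    rewrite -ltnS (leq_trans _ dU) // ltnS ltn_neqAle dimvS // andbT.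
    by apply: contra_not_neq neq => dE; apply/eqP; rewrite eqEdim WU dE leqnn.
  have [S simS SW] := IHm W dW lW W0.
  by exists S => //; apply: subv_trans WU.
exists U => //; split=> // W lW WU.
have [->|/eqP W0] := eqVneq W 0%VS; first by left.
have [->|/eqP neq] := eqVneq W U; first by right.
by case: no; exists W.
Qed.

Variable tau : B -> K.
Hypothesis tau_nondegenerate : forall s, (forall y, tau (y * s) = 0) -> s = 0.
Hypothesis tau_sqr0 : forall z, z * z = 0 -> tau z = 0.

(* Brauer's lemma *)
Lemma simple_left_ideal_unit S : simple_left_ideal S ->
  exists2 e, e \in S & forall s, s \in S -> s * e = s.
Proof.
case=> lS S0 minS.
(* Otherwise y s squares to zero for all y and all s in S, so nondegeneracy of [tau] gives S = 0. *)
have [a [s [Sa Ss sa]]] : exists a s, [/\ a \in S, s \in S & s * a != 0].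
  have [//|no] := boolp.EM (exists a s, [/\ a \in S, s \in S & s * a != 0]).
  case: S0; apply/eqP; rewrite -subv0; apply/subvP=> s Ss; rewrite memv0.
  apply/eqP/tau_nondegenerate => y; apply: tau_sqr0; apply/eqP/negPn/negP=> neq.
  by case: no; exists (y * s), (y * s); rewrite lS.
have SaE : (amulr a @: S)%VS = S.
  case: (minS (amulr a @: S)%VS) => //.
  - exact: left_ideal_amulr.
  - by apply/subvP=> _ /memv_imgP[u _ ->]; rewrite lfunE /= lS.
  move=> E; case/eqP: sa; apply/eqP; rewrite -memv0 -E.
  by apply/memv_imgP; exists s; rewrite ?lfunE.
have annE : (S :&: lker (amulr a))%VS = 0%VS.
  case: (minS (S :&: lker (amulr a))%VS) => //.
  - exact: left_ideal_annihilator.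
  - exact: capvSl.
  move=> E; case/eqP: sa; move: Ss; rewrite -E memv_cap memv_ker lfunE /=.
  by case/andP=> _ /eqP.
have : a \in (amulr a @: S)%VS by rewrite SaE.
case/memv_imgP=> e Se; rewrite lfunE /= => ea; exists e => // u Su.
apply/eqP; rewrite -subr_eq0 -memv0 -annE memv_cap rpredB ?lS //=.
by rewrite memv_ker lfunE /= mulrBl -mulrA -ea subrr.
Qed.

(** Peirce decomposition: x = x e + (x - x e) splits a simple ideal off U, with complement the
    annihilator of e in U. *)
Lemma left_ideal_decomposition U : left_ideal U ->
  exists (k : nat) (S : 'I_k -> {vspace B}),
    [/\ forall i, simple_left_ideal (S i), directv (\sum_i S i)%VS
      & (\sum_i S i)%VS = U].
Proof.
move: {2}(\dim U).+1 (ltnSn (\dim U)) => m; elim: m U => // m IHm U dU lU.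
have [->|/eqP U0] := eqVneq U 0%VS.
  exists 0%N, (fun _ => 0%VS); split; first by case.
    by rewrite directvE /= !big_ord0 dimv0.
  by rewrite big_ord0.
have [S simS SU] := exists_simple_left_ideal lU U0.
have [lS S0 _] := simS; have [e Se eP] := simple_left_ideal_unit simS.
pose V := (U :&: lker (amulr e))%VS.
have lV : left_ideal V by apply: left_ideal_annihilator.
have SV : (S :&: V)%VS = 0%VS.
  apply/eqP; rewrite -subv0; apply/subvP=> x; rewrite !memv_cap memv_ker lfunE /=.
  by case/and3P=> Sx _; rewrite eP // memv0.
have SVU : (S + V)%VS = U.
  apply/eqP; rewrite eqEsubv subv_add SU capvSl /=; apply/subvP=> x Ux.
  have xe : x * e \in S by apply: lS.
  rewrite -[x](subrK (x * e)) addrC; apply: memv_add => //.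
  rewrite memv_cap; apply/andP; split; first by rewrite rpredB //; apply: (subvP SU).
  by rewrite memv_ker lfunE /= mulrBl -mulrA (eP e Se) subrr.
have dSV := dimv_disjoint_sum SV; rewrite SVU in dSV.
have [||k [T [simT dirT sumT]]] := IHm V => //.
  rewrite -ltnS (leq_trans _ dU) // ltnS dSV -[ltnLHS]add0n ltn_add2r lt0n dimv_eq0.
  exact/eqP.
exists k.+1, (fun i => if unlift ord0 i is Some j then T j else S).
have sumE : (\sum_i (if unlift ord0 i is Some j then T j else S) = S + V)%VS.
  rewrite big_ord_recl unlift_none -sumT; congr (_ + _)%VS.
  by apply: eq_bigr => i _; rewrite liftK.
split; last by rewrite sumE.
  by move=> i; case: unliftP => [j|] _.
move: dirT; rewrite !directvE /= sumE sumT SVU dSV => /eqP ->.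
rewrite big_ord_recl unlift_none; apply/eqP; congr addn.
by apply: eq_bigr => i _; rewrite liftK.
Qed.

Lemma semisimple_of_trace : semisimple B.
Proof. by apply: left_ideal_decomposition => y u _; apply: memvf. Qed.

End Semisimple.

(** * The two-tonal algebras *)

Section TwoTonal.
Variables (K : fieldType) (n : nat) (delta : K).
Hypothesis char0 : forall m, m.+1%:R != 0 :> K.
Hypothesis n_gt0 : (0 < n)%N.
Local Notation A := (partition_algebra n delta).
Local Notation B := (two_tonal_algebra n delta).
Local Notation e := (@diagram_vec K n delta).
Implicit Types (p q : diagram n) (f g : {set 'I_n}).
Local Opaque compose loops two_tonal rk partition_mul.

Lemma two_tonal_span_even (y : A) :
  y \in two_tonal_span n delta -> supported_even y.
Proof.
rewrite /two_tonal_span; set X := [seq _ | p in _]; move=> yX p.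
apply: contraR => np; apply/eqP.
rewrite (coord_span (X := in_tuple X) yX) sum_ffunE big1 // => i _.
rewrite partition_coefZ; have : X`_i \in X by apply: mem_nth.
case/imageP=> q tq ->; rewrite ffunE; case: eqP => [E|_]; last by rewrite mulr0.
by case/negP: np; rewrite E.
Qed.

Lemma even_two_tonal_span (y : A) :
  supported_even y -> y \in two_tonal_span n delta.
Proof.
move=> ey; rewrite (diagram_vec_sum y); apply: memv_suml => p _.
have [->|yp] := eqVneq (y p) 0; first by rewrite scale0r mem0v.
by apply/memvZ/memv_span/imageP; exists p; first exact: ey.
Qed.

(** Without propagating parts the whole upper row is a union of even parts. *)
Lemma rk1_even p : two_tonal p -> rk p = 1%N -> ~~ odd n.
Proof.
move=> /two_tonal_saturated tp rp.
suff /tp : saturated p [set: 'I_n] set0 by rewrite cardsT card_ord cards0 => ->.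
have satT : saturated p [set: 'I_n] [set: 'I_n].
  by apply/saturatedP=> -[i|i] [j|j] _; rewrite !inE.
exact: rk1_product rp satT (saturated0 p).
Qed.

Lemma two_tonal_semisimple : (forall i : nat, delta != i.+1%:R) ->
  delta != 0 \/ odd n -> semisimple B.
Proof.
move=> d_ok d0.
pose tau (z : B) : K := extend (closure_trace delta) (vsval z : A).
have {}d0 : delta != 0 \/ (forall p, two_tonal p -> rk p != 1%N).
  case: d0 => [|on]; [by left|right=> p tp; apply/eqP => /(rk1_even tp)].
  by rewrite on.
have tr := closure_trace_function delta n_gt0.
apply: (@semisimple_of_trace _ _ tau) => [s orth|z zz].
  apply: val_inj; apply: (closure_trace_nondegenerate char0 n_gt0 d_ok).
    exact/two_tonal_span_even/(valP s).
  move=> p tp.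
  have ep : e p \in two_tonal_span n delta by apply/even_two_tonal_span/diagram_even.
  exact: (orth (Subvs ep)).
apply: (trace_kills_sqr0 char0 d0 tr); first exact/two_tonal_span_even/(valP z).
exact: (congr1 val zz).
Qed.

Lemma not_semisimple (x : A) : supported_even x -> x != 0 ->
  (forall q, x * e q * x = 0) -> ~ semisimple B.
Proof.
move=> ex x0 xqx ss; have xS := even_two_tonal_span ex.
suff x0B : Subvs xS = 0 :> B by case/eqP: x0; apply: (congr1 val x0B).
apply: semisimple_sandwich0 => // y; apply: val_inj.
change (x * vsval y * x = 0).
rewrite (diagram_vec_sum (vsval y : A)) mulr_sumr mulr_suml big1 // => q _.
by rewrite -scalerAr -scalerAl xqx scaler0.
Qed.

Definition row_diagram : diagram n :=
  label_diagram (fun x : node n => if x is inl _ then true else false).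

Lemma saturated_row_diagram f g :
  saturated row_diagram f g = (f \in [set set0; setT]) && (g \in [set set0; setT]).
Proof.
have cst (h : {set 'I_n}) : reflect (forall i j, (i \in h) = (j \in h))
    (h \in [set set0; setT]).
  rewrite in_set2; apply: (iffP orP) => [[]/eqP-> i j|H]; rewrite ?inE //.
  have [->|[i hi]] := set_0Vmem h; first by left.
  by right; apply/eqP/setP=> j; rewrite inE (H j i).
apply/saturated_labelP/andP=> [sat|[/cst cf /cst cg] [i|i] [j|j] //= _].
  split; apply/cst=> i j.
    by have := sat (inl i) (inl j) erefl; rewrite !inE.
  by have := sat (inr i) (inr j) erefl; rewrite !inE.
- by rewrite !inE.
- by rewrite !inE.
Qed.

Lemma delta0_not_semisimple : delta = 0 -> ~~ odd n -> ~ semisimple B.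
Proof.
move=> d0 en; pose c := row_diagram.
have tc : two_tonal c.
  apply/two_tonal_saturated=> f g; rewrite saturated_row_diagram !in_set2.
  have oT : odd #|[set: 'I_n]| = false by rewrite cardsT card_ord (negbTE en).
  by case/andP=> /orP[]/eqP-> /orP[]/eqP->; rewrite ?oT ?cards0.
apply: (@not_semisimple (e c)); first exact: diagram_even.
  apply/eqP=> /ffunP/(_ c)/eqP; rewrite !ffunE eqxx oner_eq0 //.
move=> q; rewrite diagram_mul -scalerAl diagram_mul scalerA.
suff : (0 < loops (compose c q) c)%N.
  by case: loops => // l _; rewrite d0 exprS mul0r mulr0 scale0r.
(* Without loops only one middle set would be admissible, but the empty and the full set both are,
   and they differ as n > 0. *)
rewrite lt0n; apply/eqP=> l0; have := count_middle (compose c q) c set0 set0.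
rewrite l0 saturated0 => /eqP/cards1P[g0 E].
have mem g : saturated (compose c q) set0 g -> saturated c g set0 -> g = g0.
  by move=> s1 s2; apply/set1P; rewrite -E inE s1.
have sT : saturated q setT setT by apply/saturatedP=> -[i|i] [j|j] _; rewrite !inE.
have m0 := mem set0 (saturated0 _) (saturated0 _).
have /setP/(_ (Ordinal n_gt0)) : setT = set0 :> {set 'I_n}.
  rewrite m0; apply: mem; last by rewrite saturated_row_diagram !in_set2 !eqxx ?orbT.
  by apply/saturated_composeP; exists setT; rewrite // saturated_row_diagram !in_set2 !eqxx ?orbT.
by rewrite !inE.
Qed.

End TwoTonal.

(** * Sandwich-zero elements for positive integers delta *)

Section PairDiagrams.
Variable N : nat.
Local Notation n := (N + N)%N.
Implicit Types (w : 'S_N) (f g : {set 'I_n}).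
Local Opaque compose loops two_tonal rk partition_mul join_parts.

(* The upper nodes a and N + w a are paired; the lower nodes form one part. *)
Definition pair_label w (x : node n) : option 'I_N :=
  match x with
  | inl i => Some (match split i with inl a => a | inr b => (w^-1)%g b end)
  | inr _ => None
  end.

Definition pair_diagram w : diagram n := label_diagram (pair_label w).

Lemma pair_label_lshift w a : pair_label w (inl (lshift N a)) = Some a.
Proof. by rewrite /pair_label (unsplitK (inl a)). Qed.

Lemma pair_label_rshift w a : pair_label w (inl (rshift N (w a))) = Some a.
Proof. by rewrite /pair_label (unsplitK (inr (w a))) permK. Qed.

Lemma label_pairP (T : Type) w (F : node n -> T) :
  (forall x y, pair_label w x = pair_label w y -> F x = F y)
  <-> (forall a, F (inl (lshift N a)) = F (inl (rshift N (w a))))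
      /\ (forall i j, F (inr i) = F (inr j)).
Proof.
split=> [H|[Hl Hr] x y].
  by split=> [a|i j]; apply: H; rewrite ?pair_label_lshift ?pair_label_rshift.
pose r (x : node n) : node n := if pair_label w x is Some a then inl (lshift N a) else x.
have rE z : F (r z) = F z.
  case: z => // i; rewrite /r; case: (split_ordP i) => a ->.
    by rewrite pair_label_lshift.
  by rewrite -[a](permKV w) pair_label_rshift Hl.
move=> xy; rewrite -rE -[RHS]rE /r -xy; case E: (pair_label w x) => //.
by move: x y E xy => [i|i] [j|j] //.
Qed.

Lemma saturated_pair_diagramP w f g :
  reflect ((forall a, (lshift N a \in f) = (rshift N (w a) \in f))
           /\ (forall i j, (i \in g) = (j \in g)))
          (saturated (pair_diagram w) f g).
Proof.
have := label_pairP w (fun x : node n => x \in row_union f g).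
case=> H1 H2; apply: (iffP (saturated_labelP _ _ _)) => [/H1[Hl Hr]|[Hl Hr]].
  split=> [a|i j]; first by have := Hl a; rewrite !inE.
  by have := Hr i j; rewrite !inE.
by apply: H2; split=> [a|i j]; rewrite !inE.
Qed.

Lemma pair_diagram_two_tonal w : two_tonal (pair_diagram w).
Proof.
apply/two_tonal_saturated=> f g /saturated_pair_diagramP[Hf Hg].
have -> : odd #|f| = false.
  rewrite -sum1_card big_mkcond big_split_ord /=.
  rewrite [X in (_ + X)%N](reindex_inj (@perm_inj _ w)) /= -big_split /=.
  elim/big_ind: _ => // [x y|a _]; first by rewrite oddD => -> ->.
  by rewrite Hf; case: ifP.
have [->|[i gi]] := set_0Vmem g; first by rewrite cards0.
have -> : g = setT by apply/setP=> j; rewrite inE (Hg j i).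
by rewrite cardsT card_ord oddD addbb.
Qed.

Lemma pair_diagram_inj : injective pair_diagram.
Proof.
move=> v w E; apply/permP=> a.
have : saturated (pair_diagram v) [set lshift N a; rshift N (v a)] set0.
  apply/saturated_pair_diagramP; split=> [b|i j]; last by rewrite !inE.
  rewrite !inE !(inj_eq (@lshift_inj _ _)) !(inj_eq (@rshift_inj _ _)).
  by rewrite eq_lrshift eq_rlshift orbF (inj_eq perm_inj).
rewrite E => /saturated_pair_diagramP[/(_ a) + _].
rewrite !inE eqxx /= eq_rlshift /= (inj_eq (@rshift_inj _ _)).
by move/esym/eqP.
Qed.

(** The upper pairs of v survive and the lower row is one part for every w, so w affects the product
    only through the loops. *)
Lemma compose_pair_diagram v w q :
  compose (compose (pair_diagram v) q) (pair_diagram w) = pair_diagram v.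
Proof.
apply: diagram_ext => f g.
  case/saturated_composeP=> y /saturated_composeP[z /saturated_pair_diagramP[Hf _] _].
  by case/saturated_pair_diagramP=> _ Hg; apply/saturated_pair_diagramP.
case/saturated_pair_diagramP=> Hf Hg; apply/saturated_composeP; exists set0.
  apply/saturated_composeP; exists set0; last exact: saturated0.
  by apply/saturated_pair_diagramP; split=> // i j; rewrite !inE.
by apply/saturated_pair_diagramP; split=> // a; rewrite !inE.
Qed.

Lemma compatible_pair_diagram (T : finType) w (F : {ffun node n -> T}) :
  compatible (flip (pair_diagram w)) F
  = [forall i, forall j, F (inl i) == F (inl j)]
    && [forall a, F (inr (lshift N a)) == F (inr (rshift N (w a)))].
Proof.
have [H1 H2] := label_pairP w (fun x => F (swap x)).
apply/compatibleP/andP=> [H|[/forallP Hr /forallP Hl] x y].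
  have /H1[Hl Hr] : forall x y, pair_label w x = pair_label w y -> F (swap x) = F (swap y).
    by move=> x y xy; apply: H; rewrite pblock_flip !swapK pblock_label xy.
  split; last by apply/forallP=> a; rewrite Hl.
  by apply/forallP=> i; apply/forallP=> j; rewrite (Hr i j).
rewrite pblock_flip pblock_label => /eqP/H2; rewrite !swapK; apply; split=> [a|i j] /=.
  exact/eqP.
by have /forallP/(_ j)/eqP := Hr i.
Qed.

(* The signed sum is a determinant with two equal rows, by the pigeonhole
   principle. *)
Lemma signed_compatible0 (K : fieldType) (m : nat) (F : {ffun node n -> 'I_m}) :
  (m < N)%N ->
  \sum_(w : 'S_N) (-1) ^+ w * (compatible (flip (pair_diagram w)) F)%:R = 0 :> K.
Proof.
move=> mN; pose c : bool := [forall i, forall j, F (inl i) == F (inl j)].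
pose M : 'M[K]_N := \matrix_(a, b) (F (inr (lshift N a)) == F (inr (rshift N b)))%:R.
transitivity (c%:R * \det M).
  rewrite /determinant mulr_sumr; apply: eq_bigr => w _.
  rewrite compatible_pair_diagram -/c -mulnb natrM mulrCA; congr (_ * (_ * _)).
  under eq_bigr do rewrite mxE.
  case: forallP => [H|H].
    by rewrite big1 // => a _; rewrite H.
  have [a Ha] : exists a, F (inr (lshift N a)) != F (inr (rshift N (w a))).
    by apply/existsP; rewrite -negb_forall; apply/forallP.
  by rewrite (bigD1 a) //= (negbTE Ha) mul0r.
suff [a1 [a2 [neq E]]] : exists a1 a2, a1 != a2 /\
    F (inr (lshift N a1)) = F (inr (lshift N a2)).
  rewrite (determinant_alternate neq) ?mulr0 // => b.
  by rewrite !mxE E.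
have /injectivePn[a1 [a2 neq E]] : ~~ injectiveb (fun a => F (inr (lshift N a))).
  by apply/injectiveP=> /leq_card; rewrite !card_ord leqNgt mN.
by exists a1, a2.
Qed.

(** Multiplying by a nonzero power of m independent of w turns each term into a number of colourings
    of a join with m colours; for each fixed colouring the signed sum over w vanishes. *)
Lemma signed_loops0 (K : fieldType) (m : nat) (v : 'S_N) (q : diagram n) :
  m%:R != 0 :> K -> (m < N)%N ->
  \sum_(w : 'S_N) (-1) ^+ w * m%:R ^+ loops (compose (pair_diagram v) q) (pair_diagram w)
    = 0 :> K.
Proof.
move=> m0 mN; pose P := compose (pair_diagram v) q.
apply: (mulIf (expf_neq0 (join_parts (pair_diagram v) (id_diagram n)) m0)).
rewrite mul0r mulr_suml.
transitivity (\sum_(w : 'S_N) \sum_(F : {ffun node n -> 'I_m} | compatible P F)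
    ((-1) ^+ w * (compatible (flip (pair_diagram w)) F)%:R) : K).
  apply: eq_bigr => w _; rewrite -mulrA -exprD.
  have -> : (loops P (pair_diagram w) + join_parts (pair_diagram v) (id_diagram n)
             = join_parts P (flip (pair_diagram w)))%N.
    by rewrite join_parts_flip compose_pair_diagram.
  rewrite -natrX -[m in LHS]card_ord -card_compatible.
  rewrite -sum1_card natr_sum mulr_sumr big_mkcond [RHS]big_mkcond /=.
  apply: eq_bigr => F _; rewrite inE; case: (compatible P F) => //=.
  by case: (compatible _ F); rewrite ?mulr0 ?mulr1.
by rewrite exchange_big big1 // => F _; apply: signed_compatible0.
Qed.

(* The upper halves of the pair diagrams, summed with signs, lie in the radical
   of the form given by the number of components. *)
Lemma natr_not_semisimple (K : fieldType) (m : nat) : m%:R != 0 :> K -> (m < N)%N ->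
  ~ semisimple (two_tonal_algebra n (m%:R : K)).
Proof.
move=> m0 mN.
pose x : partition_algebra n (m%:R : K) :=
  \sum_(w : 'S_N) (-1) ^+ w *: diagram_vec m%:R (pair_diagram w).
have xE p : x p = \sum_(w : 'S_N) (-1) ^+ w * (p == pair_diagram w)%:R :> K.
  by rewrite sum_ffunE; apply: eq_bigr => w _; rewrite partition_coefZ ffunE.
apply: (@not_semisimple _ _ _ x).
- move=> p; apply: contraR => np; rewrite xE big1 // => w _.
  by case: eqP => [E|_]; [rewrite E pair_diagram_two_tonal in np|rewrite mulr0].
- apply/eqP=> /ffunP/(_ (pair_diagram 1)); rewrite [RHS]ffunE xE => /eqP.
  rewrite (bigD1 1%g) //= eqxx odd_perm1 mulr1 big1 ?addr0 ?oner_eq0 // => w w1.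
  by rewrite (inj_eq pair_diagram_inj) eq_sym (negbTE w1) mulr0.
move=> q; rewrite -mulrA [LHS]mulr_suml big1 // => v _.
rewrite -scalerAl mulrA diagram_mul -scalerAl [_ * x]mulr_sumr.
transitivity ((-1) ^+ v *: (m%:R ^+ loops (pair_diagram v) q *:
   ((\sum_(w : 'S_N) (-1) ^+ w * m%:R ^+ loops (compose (pair_diagram v) q) (pair_diagram w))
    *: (diagram_vec m%:R (pair_diagram v) : partition_algebra n (m%:R : K))))); last first.
  by rewrite signed_loops0 // scale0r !scaler0.
congr (_ *: (_ *: _)); rewrite scaler_suml; apply: eq_bigr => w _.
by rewrite -scalerAr diagram_mul scalerA compose_pair_diagram.
Qed.

End PairDiagrams.

Theorem theorem5p16 (R : realType) (delta : R[i]) :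
  ((forall n : nat, (0 < n)%N -> semisimple (two_tonal_algebra n delta))
     <-> ~ (exists m : nat, delta = m%:R))
  /\ (delta = 0 ->
      forall n : nat, (0 < n)%N ->
        (semisimple (two_tonal_algebra n delta) <-> odd n)).
Proof.
have char0 m : m.+1%:R != 0 :> R[i] by rewrite Num.Theory.pnatr_eq0.
split.
  split=> [ss [m dE]|no n n0].
    case: m dE => [|m] dE.
      by apply: (@delta0_not_semisimple _ 2 delta) => //; apply: ss.
    (* One more pair than there are colours, as the pigeonhole argument requires. *)
    have := @natr_not_semisimple m.+2 _ m.+1 (char0 m) (ltnSn _).
    by rewrite -dE; apply; apply: ss.
  apply: two_tonal_semisimple => // [i|].
    by apply/eqP=> dE; case: no; exists i.+1.
  by left; apply/eqP=> dE; case: no; exists 0%N.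
move=> d0 n n0; split=> [ss|on].
  by apply/negPn/negP=> en; apply: delta0_not_semisimple ss.
apply: two_tonal_semisimple => // [i|]; last by right.
by rewrite d0 eq_sym.
Qed.
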